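(* Let $X$ be a Banach space and let $Y$ be a minimal Banach space. (i) If there exists a uniform embedding $X\to Y$, then there exists a map $X\to Y$ which is simultaneously a coarse embedding and a uniform embedding. (ii) If there exists a coarse embedding $X\to Y$, then there exists a map $f:X\to Y$ which is simultaneously a coarse embedding and a homeomorphism onto its image $f(X)$, and whose inverse $f^{-1}:f(X)\to X$ is uniformly continuous.
   Context: For a map $f:(M,d)\to(N,\partial)$ between metric spaces and $t\ge 0$, let $\omega_f(t)=\sup\{\partial(f(x),f(y)) : d(x,y)\le t\}$ and $\rho_f(t)=\inf\{\partial(f(x),f(y)) : d(x,y)\ge t\}$ (with $\inf\emptyset=\infty$). The map $f$ need not be continuous unless stated. $f$ is coarse if $\omega_f(t)<\infty$ for all $t\ge 0$; expanding if $\lim_{t\to\infty}\rho_f(t)=\infty$; a coarse embedding if it is both coarse and expanding; a uniform embedding if $\lim_{t\to 0^+}\omega_f(t)=0$ and $\rho_f(t)>0$ for all $t>0$. Banach spaces carry their norm metrics. An infinite dimensional Banach space is called minimal if it isomorphically (linearly) embeds into all of its infinite dimensional closed subspaces. *)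

(* Defs.v *)
From HB Require Import structures.
From mathcomp Require Import all_boot all_order all_algebra.
From mathcomp Require Import all_classical all_reals all_analysis.

Set Implicit Arguments.
Unset Strict Implicit.
Unset Printing Implicit Defensive.

Import Order.TTheory GRing.Theory Num.Theory.
Import numFieldNormedType.Exports.

Local Open Scope classical_set_scope.
Local Open Scope ring_scope.

(* The metric on a normed space is the norm metric [`|x - y|]. *)
Section CoarseGeometry.
Context {R : realType} {M N : normedModType R}.
Implicit Type f : M -> N.

Definition expansion_modulus f (t : R) : \bar R :=
  ereal_sup [set `|f p.1 - f p.2|%:E | p in [set p : M * M | `|p.1 - p.2| <= t]].

(* The infimum of the empty set is +oo, as [ereal_inf set0 = +oo]. *)
Definition compression_modulus f (t : R) : \bar R :=
  ereal_inf [set `|f p.1 - f p.2|%:E | p in [set p : M * M | t <= `|p.1 - p.2|]].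

Definition coarse f : Prop :=
  forall t : R, 0 <= t -> (expansion_modulus f t < +oo)%E.

Definition expanding f : Prop :=
  compression_modulus f t @[t --> +oo] --> +oo%E.

Definition coarse_embedding f : Prop := coarse f /\ expanding f.

Definition uniform_embedding f : Prop :=
  expansion_modulus f t @[t --> 0^'+] --> 0%E /\
  forall t : R, 0 < t -> (0 < compression_modulus f t)%E.

End CoarseGeometry.

(* [g] is total, but only its restriction to [range f] matters: [cancel f g]
   says that this restriction is the inverse of the bijection of [f] onto
   [range f], and it is continuous for the subspace topology. *)
Definition homeomorphism_onto_range (S T : topologicalType)
    (f : S -> T) (g : T -> S) : Prop :=
  [/\ cancel f g, continuous f & {within range f, continuous g}].

Definition unif_continuous_on (S T : uniformType) (A : set S) (g : S -> T) : Prop :=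
  unif_continuous (g : subspace A -> T).

Section Minimal.
Context {R : realType}.

Definition finite_dimensional (V : lmodType R) (Z : set V) : Prop :=
  exists (n : nat) (e : 'I_n -> V), (forall i, Z (e i)) /\
    forall x, Z x -> exists a : 'I_n -> R, x = \sum_(i < n) a i *: e i.

Definition isomorphic_embedding (V W : normedModType R) (T : {linear V -> W}) : Prop :=
  exists c C : R, [/\ 0 < c, 0 < C &
    forall x : V, c * `|x| <= `|T x| /\ `|T x| <= C * `|x|].

Definition minimal_space (Y : normedModType R) : Prop :=
  ~ finite_dimensional [set: Y] /\
  forall Z : set Y, submod_closed [in Z] -> closed Z -> ~ finite_dimensional Z ->
    exists T : {linear Y -> Y}, isomorphic_embedding T /\ range T `<=` Z.

End Minimal.

(* Main.v *)
Require Import Defs.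
From HB Require Import structures.
From mathcomp Require Import all_boot all_order all_algebra.
From mathcomp Require Import finmap wochoice.
From mathcomp Require Import all_classical all_reals all_analysis.
From mathcomp Require Import ring lra.
Set Implicit Arguments.
Unset Strict Implicit.
Unset Printing Implicit Defensive.
Import Order.TTheory GRing.Theory Num.Theory.
Import numFieldNormedType.Exports.
Local Open Scope classical_set_scope.
Local Open Scope ring_scope.

(** Let [Y] be minimal.

    The linear part of the proof shows that [Y] contains an isomorphic copy of
    [Y * Y] ([minimal_square]).  Minimality gives an isomorphic embedding [T]
    of [Y] into a subspace of infinite codimension.  The path of operators
    [(1 - t) * sigma + t T], with [sigma = 1] or [sigma = -1], joins an
    invertible operator to one whose range has infinite codimension.  The
    codimension of the range stays finite, or stays infinite, along a path of
    operators that are bounded below on subspaces of finite codimension, so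
    some operator of the path is small somewhere on each such subspace
    ([pencil_not_semi_fredholm]).  Dividing by [t], [T] is as close as desired
    to a negative multiple of the identity on an infinite dimensional closed
    subspace, and to a positive multiple on another one.  A vector near both
    would be sent near two different multiples of itself, so the two subspaces
    form a closed direct sum, and each of them contains a copy of [Y].  (In
    particular a minimal space is not hereditarily indecomposable; the usual
    route to this fact goes through the spectral theory of such spaces.)

    With [T1] and [T2] embedding [Y] onto the two summands, scaled so that
    [`|a| + `|b| <= `|T1 a + T2 b|], the map [F x = \sum_n T2 ^ n (T1 (f n x))]
    satisfies [`|f n x - f n y| <= `|F x - F y|] for every [n]
    ([superposition]): the [f n] can be treated as if they had values in
    independent directions, as long as the series converges.

    For a uniform embedding [f], the maps [f n x = n * f (x / a n)], with [a n]
    so large that the increments are summable on every bounded set, yield a map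
    that inherits the behaviour of [f] at small distances, while the [n]-th map
    separates points at distance [a n] by a multiple of [n].

    A coarse embedding [f] lies within bounded distance of a continuous one
    ([continuous_approximation]).  For a continuous [f], the maps
    [f n x = b n * f (2 ^ n x)], with [b n] decreasing fast, yield a continuous
    coarse embedding; since [f] separates points that are far apart, the [n]-th
    map separates points at distance of order [2 ^ - n], which makes the
    inverse uniformly continuous. *)

(** * Norming functionals *)

Section NormingFunctionals.
Context {R : realType} {V : normedModType R}.
Implicit Types (u v x y : V).

Definition sublinear_le_norm (q : V -> R) : Prop :=
  [/\ forall u v, q (u + v) <= q u + q v,
      forall a u, 0 <= a -> q (a *: u) <= a * q u &
      forall u, q u <= `|u|].

Definition norm1_functional (phi : V -> R) : Prop :=
  (forall a u v, phi (a *: u + v) = a * phi u + phi v) /\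
  (forall u, `|phi u| <= `|u|).

Lemma sublinear_ge q u : sublinear_le_norm q -> - `|u| <= q u.
Proof.
move=> [qD qZ qN]; have := qD u (- u); have := qN (- u).
have := qZ 2 0 (ler0n R 2); rewrite subrr normrN scaler0; lra.
Qed.

(** Replacing [q] by the infimum of its slopes in the direction [y] is the step
    that makes a minimal sublinear functional additive. *)
Definition slope_inf (q : V -> R) y x : R :=
  inf [set q (x + t *: y) - t * q y | t in [set t | 0 <= t]].

Lemma slope_inf_le q y x t : sublinear_le_norm q -> 0 <= t ->
  slope_inf q y x <= q (x + t *: y) - t * q y.
Proof.
move=> hq t0; apply: ge_inf; last by exists t.
exists (- `|x|) => _ [s /= s0 <-].
have [qD qZ qN] := hq.
have := qD (x + s *: y) (- x); rewrite addrAC subrr add0r.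
have /= := qN (- x); rewrite normrN.
have h1 : s * q y <= q (s *: y).
  have [->|sn0] := eqVneq s 0.
    by rewrite mul0r scale0r; have := sublinear_ge 0 hq; rewrite normr0; lra.
  have sp : 0 < s by rewrite lt_def sn0.
  have := qZ s^-1 (s *: y); rewrite invr_ge0 => /(_ s0).
  by rewrite scalerA mulVf // scale1r ler_pdivlMl.
lra.
Qed.

Lemma le_slope_inf q y x b :
  (forall t, 0 <= t -> b <= q (x + t *: y) - t * q y) -> b <= slope_inf q y x.
Proof.
move=> h; apply: lb_le_inf; last by move=> _ [t /= t0 <-]; exact: h.
by exists (q (x + 0 *: y) - 0 * q y), 0 => //=.
Qed.

Lemma slope_inf_sublinear q y :
  sublinear_le_norm q -> sublinear_le_norm (slope_inf q y).
Proof.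
move=> hq; have [qD qZ qN] := hq; split => [u v|a u a0|u].
- rewrite -lerBlDr; apply: le_slope_inf => s s0.
  rewrite lerBlDr -lerBlDl; apply: le_slope_inf => t t0.
  have := @slope_inf_le q y (u + v) (s + t) hq (addr_ge0 s0 t0).
  have := qD (u + s *: y) (v + t *: y).
  by rewrite addrACA -scalerDl; lra.
- have [->|an0] := eqVneq a 0.
    rewrite mul0r scale0r; have := slope_inf_le y 0 hq (lexx 0).
    by rewrite scale0r addr0; have := qN 0; rewrite normr0; lra.
  have ap : 0 < a by rewrite lt_def an0.
  rewrite -ler_pdivrMl //; apply: le_slope_inf => t t0.
  rewrite ler_pdivrMl //.
  apply: le_trans (slope_inf_le y _ hq (mulr_ge0 a0 t0)) _.
  by have := qZ a (u + t *: y) a0; rewrite scalerDr scalerA; lra.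
- have := slope_inf_le y u hq (lexx 0).
  by rewrite scale0r addr0; have := qN u; lra.
Qed.

Lemma sublinear_chain_lb (A : set {q | sublinear_le_norm q}) :
  total_on A (fun p q : {q | sublinear_le_norm q} =>
    `[< forall x, sval q x <= sval p x >]) ->
  A !=set0 -> exists t : {q | sublinear_le_norm q},
    forall s, A s -> forall x, sval t x <= sval s x.
Proof.
move=> Atot [a0 Aa0].
pose m x := inf [set sval q x | q in A].
have mle q x : A q -> m x <= sval q x.
  move=> Aq; apply: ge_inf; last by exists q.
  by exists (- `|x|) => _ [p Ap <-]; apply: sublinear_ge; exact: (svalP p).
have lem (b : R) x : (forall q, A q -> b <= sval q x) -> b <= m x.
  move=> h; apply: lb_le_inf; first by exists (sval a0 x), a0.
  by move=> _ [p Ap <-]; exact: h.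
suff hm : sublinear_le_norm m by exists (exist _ m hm) => s As x; exact: mle.
split => [u v|a u age0|u].
- rewrite -lerBlDr; apply: (lem _ u) => p Ap.
  rewrite lerBlDr -lerBlDl. apply: (lem _ v) => q Aq; rewrite lerBlDl.
  have [/asboolP pq|/asboolP qp] := Atot _ _ Ap Aq.
    apply: le_trans (mle q (u + v) Aq) _.
    by have [qD _ _] := svalP q; have := qD u v; have := pq u; lra.
  apply: le_trans (mle p (u + v) Ap) _.
  by have [qD _ _] := svalP p; have := qD u v; have := qp v; lra.
- have [->|an0] := eqVneq a 0.
    rewrite mul0r scale0r; apply: le_trans (mle _ 0 Aa0) _.
    by have [_ _ qN] := svalP a0; have := qN 0; rewrite normr0.
  have ap : 0 < a by rewrite lt_def an0.
  rewrite -ler_pdivrMl //; apply: lem => p Ap; rewrite ler_pdivrMl //.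
  apply: le_trans (mle p _ Ap) _.
  by have [_ qZ _] := svalP p; exact: qZ.
- by apply: le_trans (mle a0 u Aa0) _; have [_ _ qN] := svalP a0; exact: qN.
Qed.

(** A minimal sublinear functional [q] is linear: [slope_inf q y] lies below
    [q], so it equals [q], and this says [q x + q y <= q (x + y)].  Starting
    below the functional [slope_inf] of the norm in the direction [x] forces
    the value at [- x], hence at [x]. *)
Lemma norming_functional x :
  exists2 phi : V -> R, norm1_functional phi & phi x = `|x|.
Proof.
have hN : sublinear_le_norm (fun u : V => `|u|).
  split=> // [u v|a u a0]; first exact: ler_normD.
  by rewrite normrZ ger0_norm.
pose q0 := slope_inf (fun u => `|u|) x.
have hq0 : sublinear_le_norm q0 by exact: slope_inf_sublinear.
have q0x : q0 (- x) <= - `|x|.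
  have := slope_inf_le x (- x) hN ler01.
  by rewrite scale1r addNr normr0 mul1r sub0r.
pose T := {q | sublinear_le_norm q /\ forall u, q u <= q0 u}.
pose Rel (p q : T) := `[< forall x, sval q x <= sval p x >].
have [|p r s /asboolP h1 /asboolP h2|A Atot|q qmin] :=
    @ZL_preorder T (exist _ q0 (conj hq0 (fun u => lexx _))) Rel.
- by move=> t; apply/asboolP.
- by apply/asboolP => z; exact: le_trans (h2 z) (h1 z).
- have [->|/set0P [a Aa]] := eqVneq A set0.
    by exists (exist _ q0 (conj hq0 (fun u => lexx _))).
  pose B : set {q | sublinear_le_norm q} :=
    [set exist sublinear_le_norm (sval p) (proj1 (svalP p)) | p in A].
  have [||[m hm] mB] := @sublinear_chain_lb B.
  + by move=> _ _ [p Ap <-] [r Ar <-]; exact: Atot.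
  + by exists (exist sublinear_le_norm (sval a) (proj1 (svalP a))), a.
  have mq0 : forall u, m u <= q0 u.
    move=> u; apply: le_trans (proj2 (svalP a) u).
    by apply: (mB (exist _ (sval a) (proj1 (svalP a)))); exists a.
  exists (exist _ m (conj hm mq0)) => s As; apply/asboolP => z /=.
  by apply: (mB (exist _ (sval s) (proj1 (svalP s)))); exists s.
have [hq qq0] := svalP q; have [qD qZ qN] := hq.
set f := sval q in hq qq0 qD qZ qN.
have fD u v : f (u + v) = f u + f v.
  have h : sublinear_le_norm (slope_inf f v) by exact: slope_inf_sublinear.
  have le_f w : slope_inf f v w <= f w.
    by have := slope_inf_le v w hq (lexx 0); rewrite scale0r addr0 mul0r subr0.
  have le_q0 w : slope_inf f v w <= q0 w := le_trans (le_f w) (qq0 w).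
  have /asboolP/(_ u)/= : Rel (exist _ (slope_inf f v) (conj h le_q0)) q.
    by apply: qmin; apply/asboolP => w /=; exact: le_f.
  have := slope_inf_le v u hq ler01; rewrite scale1r mul1r.
  rewrite -/f => h1 h2; apply/eqP; rewrite eq_le qD /=; lra.
have f0 : f 0 = 0 by have := fD 0 0; rewrite addr0; lra.
have fN u : f (- u) = - f u by have := fD u (- u); rewrite subrr f0; lra.
have fZ0 a u : 0 <= a -> f (a *: u) = a * f u.
  move=> a0; apply/eqP; rewrite eq_le qZ //=.
  by have := qZ a (- u) a0; rewrite scalerN !fN; lra.
have fZ a u : f (a *: u) = a * f u.
  have [/fZ0 //|a0] := leP 0 a.
  have na0 : 0 <= - a by lra.
  by have := fZ0 (- a) u na0; rewrite scaleNr fN; lra.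
exists f.
  split=> [a u v|u]; first by rewrite fD fZ.
  by rewrite ler_norml sublinear_ge //= qN.
apply/eqP; rewrite eq_le qN /=.
by have := le_trans (qq0 (- x)) q0x; rewrite fN; lra.
Qed.

(** Norm-one functionals separate points, so an identity between linear
    combinations of vectors reduces to the same identity between scalars. *)
Lemma eq_by_functionals u v :
  (forall phi : V -> R,
     (forall x y, phi (x + y) = phi x + phi y) ->
     (forall x, phi (- x) = - phi x) ->
     (forall a x, phi (a *: x) = a * phi x) ->
     phi 0 = 0 -> phi u = phi v) -> u = v.
Proof.
move=> h; have [phi [lin _] phiE] := norming_functional (u - v).
have phi0 : phi 0 = 0 by have := lin 1 0 0; rewrite scale1r addr0; lra.
have phiD x y : phi (x + y) = phi x + phi y.
  by have := lin 1 x y; rewrite scale1r mul1r.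
have phiZ a x : phi (a *: x) = a * phi x.
  by have := lin a x 0; rewrite addr0 phi0 addr0.
have phiN x : phi (- x) = - phi x by rewrite -scaleN1r phiZ mulN1r.
apply/eqP; rewrite -subr_eq0 -normr_eq0 -phiE phiD phiN.
by rewrite (h phi) // subrr.
Qed.

End NormingFunctionals.

Ltac vector_ring :=
  apply: eq_by_functionals;
  let f := fresh "phi" in let fD := fresh in let fN := fresh in
  let fZ := fresh in let f0 := fresh in
  intros f fD fN fZ f0; rewrite ?(fD, fN, fZ, f0); ring.

(** * Subspaces of finite codimension *)

Section FiniteCodimension.
Context {R : realType} {V : normedModType R}.
Implicit Types (u v x y : V) (N : set V).

Definition linear_subset N : Prop :=
  N 0 /\ forall (a : R) u v, N u -> N v -> N (a *: u + v).

Lemma linear_subsetD N u v : linear_subset N -> N u -> N v -> N (u + v).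
Proof. by move=> [_ h] Nu Nv; rewrite -[u]scale1r; exact: h. Qed.

Lemma linear_subsetZ N (a : R) u : linear_subset N -> N u -> N (a *: u).
Proof. by move=> [N0 h] Nu; rewrite -[_ *: _]addr0; exact: h. Qed.

Lemma linear_subsetB N u v : linear_subset N -> N u -> N v -> N (u - v).
Proof.
move=> hN Nu Nv; apply: linear_subsetD => //.
by rewrite -scaleN1r; exact: linear_subsetZ.
Qed.

Lemma linear_subset_image (S : {linear V -> V}) N :
  linear_subset N -> linear_subset (S @` N).
Proof.
move=> [N0 h]; split; first by exists 0 => //; rewrite linear0.
by move=> a _ _ [u Nu <-] [v Nv <-]; exists (a *: u + v); rewrite ?linearP //; exact: h.
Qed.

(** Total boundedness, at scale [e], of the image of the unit ball in the
    quotient by [N].  A finite colouring replaces the usual finite net: two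
    points of the same colour agree up to [e] modulo [N], and no choice of
    centres has to be followed when [N] changes. *)
Definition ball_tot_bounded_mod (e : R) N : Prop :=
  exists (T : finType) (chi : V -> T), forall y y',
    `|y| <= 1 -> `|y'| <= 1 -> chi y = chi y' ->
    exists2 v, N v & `|y - y' - v| <= e.

Lemma ball_tot_bounded_mod_split e N : ball_tot_bounded_mod e N ->
  exists (T : finType) (chi : V -> T) (rep : T -> V) (res : V -> V),
    forall y, `|y| <= 1 -> [/\ `|rep (chi y)| <= 1, N (res y) &
      `|y - rep (chi y) - res y| <= e].
Proof.
move=> [T [chi h]].
(* [0] is a junk value, taken for the colours that no vector of the ball has. *)
pose rep c := xget 0 [set y | `|y| <= 1 /\ chi y = c].
pose res y := xget 0 [set v | N v /\ `|y - rep (chi y) - v| <= e].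
exists T, chi, rep, res => y y1.
have [r1 rc] : [set z | `|z| <= 1 /\ chi z = chi y] (rep (chi y)).
  by apply: xgetPex; exists y.
have [Nr rr] : [set v | N v /\ `|y - rep (chi y) - v| <= e] (res y).
  apply: xgetPex; have [v Nv hv] := h y _ y1 r1 (esym rc).
  by exists v.
by [].
Qed.

(** The remainder left by the first colouring, divided by [e], lies in the unit
    ball and can be coloured again.  One scale below [1] therefore gives all
    smaller scales. *)
Lemma ball_tot_bounded_mod_sqr e N : linear_subset N -> 0 < e ->
  ball_tot_bounded_mod e N -> ball_tot_bounded_mod (e ^+ 2) N.
Proof.
move=> hN e0 hb; have [T [chi [rep [res h]]]] := ball_tot_bounded_mod_split hb.
have [T' [chi' h']] := hb.
pose z y := e^-1 *: (y - rep (chi y) - res y).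
have zE y : e *: z y = y - rep (chi y) - res y.
  by rewrite scalerA divff ?scale1r // gt_eqF.
have z1 y : `|y| <= 1 -> `|z y| <= 1.
  move=> /h[_ _ hy]; rewrite normrZ gtr0_norm ?invr_gt0 //.
  by rewrite ler_pdivrMl // mulr1.
exists (T * T')%type, (fun y => (chi y, chi' (z y))) => y y' y1 y'1 [c1 c2].
have [v Nv hv] := h' _ _ (z1 _ y1) (z1 _ y'1) c2.
have [_ Ny _] := h _ y1; have [_ Ny' _] := h _ y'1.
exists (e *: v + (res y - res y')); first by apply: hN.2 => //; exact: linear_subsetB.
have -> : y - y' - (e *: v + (res y - res y')) = e *: (z y - z y' - v).
  by rewrite !scalerBr !zE -c1; vector_ring.
by rewrite normrZ gtr0_norm // expr2 ler_pM2l.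
Qed.

Lemma finite_bucket (B d : R) : 0 < d ->
  exists (n : nat) (c : R -> 'I_n.+1), forall a b,
    `|a| <= B -> `|b| <= B -> c a = c b -> `|a - b| <= d.
Proof.
move=> d0; pose n := Num.truncn ((2 * B) / d).
exists n, (fun a => inord (Num.truncn ((a + B) / d))) => a b aB bB /(congr1 val) /=.
have in_range (x : R) : `|x| <= B -> 0 <= (x + B) / d /\ (Num.truncn ((x + B) / d) < n.+1)%N.
  rewrite ler_norml => /andP[x1 x2]; split; first by apply: divr_ge0; [lra|exact: ltW].
  by rewrite ltnS /n le_truncn // ler_pM2r ?invr_gt0 //; lra.
have [a0 an] := in_range a aB; have [b0 bn] := in_range b bB.
rewrite !inordK // => ab.
have /andP[a1 a2] := truncn_itv a0; have /andP[b1 b2] := truncn_itv b0.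
rewrite -ab in b1 b2; rewrite -natr1 in a2 b2.
have : (a + B) / d - (b + B) / d <= 1 by lra.
have : (b + B) / d - (a + B) / d <= 1 by lra.
rewrite -!mulrBl !ler_pdivrMr // !mul1r => h1 h2.
by rewrite ler_norml; apply/andP; split; lra.
Qed.

Definition functional1 := {phi : V -> R | norm1_functional phi}.

Lemma functional1B (phi : functional1) u v :
  sval phi (u - v) = sval phi u - sval phi v.
Proof.
by have := (svalP phi).1 (-1) v u; rewrite scaleN1r addrC; lra.
Qed.

(** Subspaces of finite codimension are represented by finite lists of
    functionals of norm at most one. *)
Fixpoint common_kernel (s : seq functional1) : set V :=
  if s is phi :: s' then common_kernel s' `&` [set v | sval phi v = 0] else setT.

Lemma common_kernel_linear s : linear_subset (common_kernel s).
Proof.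
elim: s => [|phi s [IH0 IH]] /=; first by split.
have phi0 : sval phi 0 = 0 by have := functional1B phi 0 0; rewrite subrr; lra.
split=> [|a u v [su phiu] [sv phiv]]; first by split.
split; first exact: IH.
by rewrite /= (svalP phi).1 phiu phiv mulr0 addr0.
Qed.

Lemma kernel_step N (phi : functional1) : linear_subset N ->
  N `<=` [set v | sval phi v = 0] \/ exists2 x, N x & sval phi x = 1.
Proof.
move=> hN; have [h|] := pselect (N `<=` [set v | sval phi v = 0]); first by left.
move=> /existsNP[x /not_implyP[Nx /eqP phix]]; right.
exists ((sval phi x)^-1 *: x); first exact: linear_subsetZ.
have := (svalP phi).1 (sval phi x)^-1 x 0; rewrite addr0 mulVf // => ->.
by have := functional1B phi 0 0; rewrite subrr; lra.
Qed.

(** The colour also records, up to a small error, the value of [phi] on the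
    component of [y] in [N]; the difference of two such components is then
    corrected into the kernel of [phi] by a small multiple of [x]. *)
Lemma ball_tot_bounded_mod_kernel N (phi : functional1) : linear_subset N ->
  (forall e, 0 < e -> ball_tot_bounded_mod e N) ->
  forall e, 0 < e -> ball_tot_bounded_mod e (N `&` [set v | sval phi v = 0]).
Proof.
move=> hN hb e e0.
have [/setIidl -> |[x Nx phix]] := kernel_step phi hN; first exact: hb.
have x0 : 0 < `|x|.
  by apply: (lt_le_trans _ ((svalP phi).2 x)); rewrite phix normr1.
have e4 : 0 < e / 4 by lra.
have [T [chi [rep [res h]]]] := ball_tot_bounded_mod_split (hb _ e4).
have [|n [c hc]] := @finite_bucket (2 + e / 4) (e / (2 * `|x|)).
  by rewrite divr_gt0 // mulr_gt0.
exists (T * 'I_n.+1)%type, (fun y => (chi y, c (sval phi (res y)))).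
move=> y y' y1 y'1 [c1 c2].
have [r1 Ny hy] := h _ y1; have [r1' Ny' hy'] := h _ y'1.
have bnd z : `|z| <= 1 -> `|sval phi (res z)| <= 2 + e / 4.
  move=> z1; have [rz _ hz] := h _ z1; apply: le_trans ((svalP phi).2 _) _.
  have -> : res z = z - rep (chi z) - (z - rep (chi z) - res z) by vector_ring.
  have := ler_normB (z - rep (chi z)) (z - rep (chi z) - res z).
  by have := ler_normB z (rep (chi z)); lra.
have := hc _ _ (bnd _ y1) (bnd _ y'1) c2; rewrite -functional1B.
set u := res y - res y' => phiu.
exists (u - sval phi u *: x); first split.
- by apply: linear_subsetB => //; [exact: linear_subsetB|exact: linear_subsetZ].
- rewrite /= functional1B.
  have := (svalP phi).1 (sval phi u) x 0.
  have := functional1B phi 0 0; rewrite subrr addr0 phix => z0 ->.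
  by rewrite mulr1 z0; lra.
- have -> : y - y' - (u - sval phi u *: x) = (y - rep (chi y) - res y) -
     (y' - rep (chi y') - res y') + sval phi u *: x.
    by rewrite -c1 /u; vector_ring.
  apply: le_trans (ler_normD _ _) _.
  have := ler_normB (y - rep (chi y) - res y) (y' - rep (chi y') - res y').
  have : `|sval phi u *: x| <= e / 2.
    rewrite normrZ -ler_pdivlMr //; apply: le_trans phiu _.
    by rewrite invfM mulrA.
  lra.
Qed.

Lemma common_kernel_tot_bounded s e : 0 < e ->
  ball_tot_bounded_mod e (common_kernel s).
Proof.
elim: s e => [|phi s IH] e e0 /=.
  exists unit, (fun=> tt) => y y' _ _ _; exists (y - y') => //.
  by rewrite subrr normr0 ltW.
by apply: ball_tot_bounded_mod_kernel => //; exact: common_kernel_linear.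
Qed.

Lemma common_kernel_complement s : exists (n : nat) (e : 'I_n -> V),
  forall y, exists a : 'I_n -> R, common_kernel s (y - \sum_(i < n) a i *: e i).
Proof.
elim: s => [|phi s [n [e he]]] /=.
  by exists 0%N, (fun=> 0) => y; exists (fun=> 0).
have [h|[x Nx phix]] := kernel_step phi (common_kernel_linear s).
  exists n, e => y; have [a ha] := he y; exists a; split => //; exact: h.
exists n.+1, (fun i => if unlift ord0 i is Some j then e j else x) => y.
have [a ha] := he y; set u := y - _ in ha.
exists (fun i => if unlift ord0 i is Some j then a j else sval phi u).
rewrite big_ord_recl unlift_none.
under eq_bigr do rewrite liftK.
have -> : y - (sval phi u *: x + \sum_(i < n) a i *: e i) = u - sval phi u *: x.
  by rewrite /u opprD addrA addrAC.
split; first by apply: linear_subsetB (common_kernel_linear s) ha _;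
  exact: linear_subsetZ (common_kernel_linear s) Nx.
rewrite /= functional1B.
have := (svalP phi).1 (sval phi u) x 0.
have := functional1B phi 0 0; rewrite subrr addr0 phix => z0 ->.
by rewrite mulr1 z0; lra.
Qed.

Lemma common_kernel_neq0 s : ~ finite_dimensional [set: V] ->
  exists2 v, common_kernel s v & v != 0.
Proof.
move=> hV; apply/not_exists2P => h; apply: hV.
have [n [e he]] := common_kernel_complement s.
exists n, e; split=> // y _; have [a ha] := he y; exists a; apply/eqP.
by rewrite -subr_eq0; have [//|/negP/negPn] := h (y - \sum_(i < n) a i *: e i).
Qed.

End FiniteCodimension.

(** * A linear path from a multiple of the identity *)

Section SemiFredholmPath.
Context {R : realType} {V : normedModType R}.
Implicit Types (u v x y : V) (N : set V).

(** The usual definition asks for a finite dimensional kernel and a closed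
    range; this is equivalent to a lower bound on a subspace of finite
    codimension. *)
Definition upper_semi_fredholm (S : V -> V) : Prop :=
  exists c s, 0 < c /\ forall v, common_kernel s v -> c * `|v| <= `|S v|.

Lemma ball_tot_bounded_mod_sub e N N' : N `<=` N' ->
  ball_tot_bounded_mod e N -> ball_tot_bounded_mod e N'.
Proof.
move=> sub [T [chi h]]; exists T, chi => y y' y1 y'1 /(h _ _ y1 y'1)[v Nv hv].
by exists v => //; exact: sub.
Qed.

Lemma ball_tot_bounded_mod_half N : linear_subset N ->
  ball_tot_bounded_mod (1 / 2) N -> ball_tot_bounded_mod (1 / 16) N.
Proof.
move=> hN h2.
have -> : 1 / 16 = ((1 / 2) ^+ 2) ^+ 2 :> R by field.
apply: ball_tot_bounded_mod_sqr => //.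
exact: ball_tot_bounded_mod_sqr.
Qed.

(** Since [v] is controlled by [B v], replacing [B v] by [A v] moves it by a
    fraction of its norm, so the colouring used for [B] also serves for [A].
    The radius [c / 8] depends on the lower bound only, not on the codimension
    of the range, and so is uniform along a path of operators. *)
Lemma ball_tot_bounded_mod_image_perturb (A B : {linear V -> V}) N c :
  linear_subset N -> 0 < c ->
  (forall v, N v -> c * `|v| <= `|B v|) ->
  (forall v, `|A v - B v| <= c / 8 * `|v|) ->
  ball_tot_bounded_mod (1 / 2) (B @` N) -> ball_tot_bounded_mod (1 / 2) (A @` N).
Proof.
move=> hN c0 hB hAB /(ball_tot_bounded_mod_half (linear_subset_image B hN)).
move=> [T [chi h]]; exists T, chi => y y' y1 y'1 /(h _ _ y1 y'1)[_ [v Nv <-] hv].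
exists (A v); first by exists v.
(* [y - y'] has norm at most [2], and the colouring errs by at most [1 / 16]. *)
have Bv : `|B v| <= 33 / 16.
  have -> : B v = (y - y') - (y - y' - B v) by vector_ring.
  apply: le_trans (ler_normB _ _) _; have := ler_normB y y'; lra.
have -> : y - y' - A v = (y - y' - B v) - (A v - B v) by vector_ring.
apply: le_trans (ler_normB _ _) _; have := hAB v; have := hB _ Nv; lra.
Qed.

(** The preimages under [S] of the components in the range are bounded, because
    [S] is bounded below on [common_kernel s]; colouring them modulo
    [common_kernel s'] moves the components into the image of the latter. *)
Lemma ball_tot_bounded_mod_image_kernel (S : {linear V -> V}) s s' c L :
  0 < c -> 0 < L ->
  (forall v, common_kernel s v -> c * `|v| <= `|S v|) ->
  (forall v, `|S v| <= L * `|v|) ->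
  ball_tot_bounded_mod (1 / 2) (S @` common_kernel s) ->
  ball_tot_bounded_mod (1 / 2) (S @` common_kernel s').
Proof.
move=> c0 L0 hc hL.
move=> /(ball_tot_bounded_mod_half (linear_subset_image S (common_kernel_linear s))).
move=> /ball_tot_bounded_mod_split[T [chi [rep [res h]]]].
pose w y := c / 3 *: xget 0 [set v | common_kernel s v /\ S v = res y].
have hw y : `|y| <= 1 -> `|w y| <= 1 /\ (3 / c) *: S (w y) = res y.
  move=> y1; have [r1 [v sv Sv] hy] := h y y1.
  have [|sx Sx] := @xgetPex _ 0 [set v | common_kernel s v /\ S v = res y].
    by exists v.
  rewrite /w linearZ /= Sx normrZ; split; last first.
    have -> : (3 / c) *: ((c / 3) *: res y) = (3 / c * (c / 3)) *: res y by rewrite scalerA.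
    have -> : 3 / c * (c / 3) = 1 by field; exact: lt0r_neq0.
    by rewrite scale1r.
  have := hc _ sx; rewrite Sx.
  have : `|res y| <= 33 / 16.
    have -> : res y = y - rep (chi y) - (y - rep (chi y) - res y) by vector_ring.
    have := ler_normB (y - rep (chi y)) (y - rep (chi y) - res y).
    by have := ler_normB y (rep (chi y)); lra.
  rewrite (gtr0_norm (_ : 0 < c / 3)) ?divr_gt0 //; lra.
pose e := c / (12 * L).
have e0 : 0 < e by rewrite divr_gt0 // mulr_gt0.
have [T' [chi' h']] := common_kernel_tot_bounded s' e0.
exists (T * T')%type, (fun y => (chi y, chi' (w y))) => y y' y1 y'1 [c1 c2].
have [w1 Sw] := hw _ y1; have [w1' Sw'] := hw _ y'1.
have [_ _ hy] := h _ y1; have [_ _ hy'] := h _ y'1.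
have [v sv hv] := h' _ _ w1 w1' c2.
exists (S ((3 / c) *: v)).
  by exists ((3 / c) *: v) => //; exact: linear_subsetZ (common_kernel_linear s') sv.
have -> : y - y' - S ((3 / c) *: v) = (y - rep (chi y) - res y) -
     (y' - rep (chi y') - res y') + (3 / c) *: S (w y - w y' - v).
  by rewrite -c1 -Sw -Sw' linearZ !linearB /=; vector_ring.
apply: le_trans (ler_normD _ _) _.
have := ler_normB (y - rep (chi y) - res y) (y' - rep (chi y') - res y').
suff : `|(3 / c) *: S (w y - w y' - v)| <= 1 / 4 by lra.
rewrite normrZ gtr0_norm ?divr_gt0 //.
have := hL (w y - w y' - v).
have : L * `|w y - w y' - v| <= L * e by rewrite ler_pM2l.
have -> : L * e = c / 12 by rewrite /e; field; rewrite gt_eqF.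
move=> h1 h2; rewrite mulrAC ler_pdivrMr //; lra.
Qed.

Definition pencil (sigma : R) (T : V -> V) (t : R) (v : V) : V :=
  ((1 - t) * sigma) *: v + t *: T v.

Lemma pencil_linear sigma (T : {linear V -> V}) t : linear (pencil sigma T t).
Proof. by move=> a u v; rewrite /pencil linearP /=; vector_ring. Qed.

HB.instance Definition _ sigma (T : {linear V -> V}) t :=
  GRing.isLinear.Build R V V _ (pencil sigma T t) (pencil_linear sigma T t).

Lemma pencil_dist sigma (T : {linear V -> V}) L t t' v : `|sigma| = 1 ->
  `|T v| <= L * `|v| ->
  `|pencil sigma T t v - pencil sigma T t' v| <= `|t - t'| * ((1 + L) * `|v|).
Proof.
move=> s1 hT.
have -> : pencil sigma T t v - pencil sigma T t' v = (t - t') *: (T v - sigma *: v).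
  by rewrite /pencil; vector_ring.
rewrite normrZ ler_wpM2l //; apply: le_trans (ler_normB _ _) _.
by rewrite normrZ s1; lra.
Qed.

Lemma pencil_bounded sigma (T : {linear V -> V}) L t v : `|sigma| = 1 ->
  0 <= t <= 1 -> `|T v| <= L * `|v| -> `|pencil sigma T t v| <= (1 + L) * `|v|.
Proof.
move=> s1 /andP[t0 t1] hT; apply: le_trans (ler_normD _ _) _.
rewrite normrZ (normrZ t) normrM s1 mulr1 (ger0_norm t0) ger0_norm ?subr_ge0 //.
have : (1 - t) * `|v| <= 1 * `|v| by rewrite ler_wpM2r //; lra.
have : t * `|T v| <= 1 * `|T v| by rewrite ler_wpM2r.
lra.
Qed.

(** If every operator of the path were upper semi-Fredholm, finiteness of the
    codimension of the range would be locally constant along the path, and so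
    would pass from the multiple of the identity at [t = 0] to [T]. *)
Lemma pencil_not_semi_fredholm sigma (T : {linear V -> V}) L : `|sigma| = 1 ->
  0 < L -> (forall v, `|T v| <= L * `|v|) ->
  ~ ball_tot_bounded_mod (1 / 2) (range T) ->
  exists2 t, 0 <= t <= 1 & ~ upper_semi_fredholm (pencil sigma T t).
Proof.
move=> s1 L0 hL hT; apply/not_exists2P => h.
have {}h t : 0 <= t <= 1 -> upper_semi_fredholm (pencil sigma T t).
  by move=> t01; have [/(_ t01)//|/contrapT] := h t.
pose P t : {linear V -> V} := pencil sigma T t.
have L1 : 0 < 1 + L by lra.
pose below c s t := 0 < c /\ forall v, common_kernel s v -> c * `|v| <= `|P t v|.
pose fin s t := ball_tot_bounded_mod (1 / 2) (P t @` common_kernel s).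
pose good t := exists c s, below c s t /\ fin s t.
have goodE t c s : 0 <= t <= 1 -> below c s t -> good t -> fin s t.
  move=> t01 [c0 hc] [c' [s' [[c'0 hc'] hf]]].
  apply: (@ball_tot_bounded_mod_image_kernel (P t) s' s c' (1 + L)) => // v.
  exact: pencil_bounded.
(* [E] contains [0] but not [1]; near its supremum [m], the lower bound at [m]
   holds with [c / 2] in place of [c], and finiteness of the codimension passes
   first from some [t] in [E] to [m], then from [m] to points beyond [m]. *)
pose E := [set t | 0 <= t <= 1 /\ good t].
have E0 : E 0.
  split; first by rewrite lexx ler01.
  exists 1, [::]; split; first split=> // v _.
    by rewrite /P /= /pencil subr0 !mul1r scale0r addr0 normrZ s1 mul1r.
  have sn0 : sigma != 0 by rewrite -normr_eq0 s1 oner_eq0.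
  exists unit, (fun=> tt) => y y' _ _ _; exists (y - y').
    exists (sigma^-1 *: (y - y')) => //.
    by rewrite /P /= /pencil subr0 mul1r scale0r addr0 scalerA divff // scale1r.
  by rewrite subrr normr0; lra.
have E1 : ~ E 1.
  move=> [_ [c [s [_ hf]]]]; apply: hT; apply: ball_tot_bounded_mod_sub hf.
  by move=> _ [v _ <-]; exists v => //; rewrite /P /= /pencil subrr mul0r scale0r add0r scale1r.
have supE : has_sup E by split; [exists 0|exists 1 => t [/andP[]]].
set m := sup E.
have m0 : 0 <= m by apply: ub_le_sup E0; exact: supE.2.
have m1 : m <= 1 by apply: ge_sup supE.1 _ => t [/andP[]].
have m01 : 0 <= m <= 1 by rewrite m0.
have [c [s [c0 hc]]] := h m m01.
pose d := c / (16 * (1 + L)).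
have d0 : 0 < d by rewrite divr_gt0 // mulr_gt0.
have near_m t v : `|t - m| <= d -> `|P t v - P m v| <= c / 16 * `|v|.
  move=> td; apply: le_trans (pencil_dist _ _ s1 (hL v)) _.
  rewrite mulrA ler_wpM2r // -ler_pdivlMr //; apply: le_trans td _.
  by rewrite /d invfM mulrA.
have below_t t : `|t - m| <= d -> below (c / 2) s t.
  move=> td; split=> [|v sv]; first lra.
  have := near_m t v td; have := hc v sv.
  have := ler_normB (P t v) (P t v - P m v).
  have -> : P t v - (P t v - P m v) = P m v by vector_ring.
  have := mulr_ge0 (ltW c0) (normr_ge0 v).
  by rewrite -/(P t v); lra.
have below_m : below c s m by [].
have below_m2 : below (c / 2) s m by apply: below_t; rewrite subrr normr0 ltW.
have c2 : 0 < c / 2 by lra.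
have good_m : good m.
  have [t Et tm] := sup_adherent d0 supE; rewrite -/m in tm.
  have tm' : t <= m by apply: ub_le_sup Et; exact: supE.2.
  have td : `|t - m| <= d by rewrite ler_norml; apply/andP; split; lra.
  exists c, s; split=> //; have [t01 gt] := Et.
  have [_ hb] := below_t t td.
  apply: (ball_tot_bounded_mod_image_perturb (common_kernel_linear s) c2 hb) => [v|].
    by rewrite distrC; have := near_m t v td; lra.
  exact: goodE (below_t t td) gt.
have m_lt1 : m < 1.
  rewrite lt_def m1 andbT; apply/eqP => m1'; apply: E1; split; first by rewrite ler01 lexx.
  by rewrite m1'.
pose t := Num.min 1 (m + d).
have mt : m < t by rewrite lt_min m_lt1; lra.
have t1 : t <= 1 by rewrite ge_min lexx.
have td : t <= m + d by rewrite ge_min lexx orbT.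
have tmd : `|t - m| <= d by rewrite ler_norml; apply/andP; split; lra.
suff /(ub_le_sup supE.2) : E t by rewrite -/m; lra.
split; first lra.
exists (c / 2), s; split; first exact: below_t.
apply: (ball_tot_bounded_mod_image_perturb (common_kernel_linear s) c2 below_m2.2).
  by move=> v; have := near_m t v tmd; lra.
exact: goodE below_m good_m.
Qed.

(** An isomorphic embedding [T] with range of infinite codimension looks like
    multiplication by a scalar of either sign on large subspaces. *)
Lemma approximate_eigenvectors sigma (T : {linear V -> V}) c L : `|sigma| = 1 ->
  0 < c -> 0 < L -> (forall v, c * `|v| <= `|T v| /\ `|T v| <= L * `|v|) ->
  ~ ball_tot_bounded_mod (1 / 2) (range T) ->
  exists2 mu, sigma * mu < 0 & forall s e, 0 < e ->
    exists v, [/\ common_kernel s v, `|v| = 1 & `|T v - mu *: v| <= e].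
Proof.
move=> s1 c0 L0 hT inf.
have [//|t t01 ht] := @pencil_not_semi_fredholm sigma T L s1 L0 _ inf.
  by move=> v; have [] := hT v.
have sn0 : sigma != 0 by rewrite -normr_eq0 s1 oner_eq0.
have ss : sigma * sigma = 1.
  by rewrite -expr2 -(ger0_norm (sqr_ge0 sigma)) normrX s1 expr1n.
have t_neq0 : t != 0.
  apply/eqP => t0; apply: ht; exists 1, [::]; split=> // v _.
  by rewrite t0 /= /pencil subr0 !mul1r scale0r addr0 normrZ s1 mul1r.
have t_neq1 : t != 1.
  apply/eqP => t1; apply: ht; exists c, [::]; split=> // v _.
  by rewrite t1 /pencil subrr mul0r scale0r add0r scale1r; have [] := hT v.
have /andP[t0 t1] : 0 < t < 1 by rewrite !lt_def t_neq0 eq_sym t_neq1.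
exists (- ((1 - t) / t) * sigma).
  rewrite mulrCA ss mulr1 oppr_lt0 divr_gt0 //; lra.
move=> s e e0; apply: contrapT => hn; apply: ht.
exists (t * e), s; split=> [|v sv]; first exact: mulr_gt0.
rewrite leNgt; apply/negP => hv; apply: hn.
have v0 : 0 < `|v|.
  rewrite lt_def normr_ge0 andbT; apply/eqP => v0; move: hv.
  by rewrite v0 mulr0 ltNge normr_ge0.
exists (`|v|^-1 *: v); split.
- exact: linear_subsetZ (common_kernel_linear s) sv.
- by rewrite normrZ gtr0_norm ?invr_gt0 // mulVf // gt_eqF.
- have -> : T (`|v|^-1 *: v) - (- ((1 - t) / t) * sigma) *: (`|v|^-1 *: v) =
      (t * `|v|)^-1 *: pencil sigma T t v.
    have tv : t * `|v| != 0 by rewrite mulf_neq0 // gt_eqF.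
    apply: (scalerI tv); rewrite [RHS]scalerA divff // scale1r linearZ /= /pencil.
    have -> : (t * `|v|) *: (`|v|^-1 *: T v - (- ((1 - t) / t) * sigma) *: (`|v|^-1 *: v))
      = (t * (`|v| / `|v|)) *: T v + ((1 - t) * sigma * (t / t) * (`|v| / `|v|)) *: v.
      by vector_ring.
    by rewrite !divff ?gt_eqF // !mulr1 addrC.
  rewrite normrZ gtr0_norm ?invr_gt0 ?mulr_gt0 //.
  by rewrite mulrC ler_pdivrMr ?mulr_gt0 // mulrCA mulrA ltW.
Qed.

End SemiFredholmPath.

(** * Triangular sequences and their closed spans *)

Section TriangularSequences.
Context {R : realType} {V : normedModType R}.
Implicit Types (u v w y : V) (N : set V).

(** A weak form of a basic sequence: the partial sum projections may be
    unbounded, but the coefficient functionals obey the bounds [2 ^ k], which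
    are known before the sequence is chosen. *)
Definition triangular (x : nat -> V) : Prop :=
  (forall k, `|x k| = 1) /\
  exists phi : nat -> functional1, (forall k, sval (phi k) (x k) = 1) /\
    forall k i, (k < i)%N -> sval (phi k) (x i) = 0.

Definition represents (x : nat -> V) (a : nat -> R) v : Prop :=
  exists n, (forall i, (n <= i)%N -> a i = 0) /\ v = \sum_(0 <= i < n) a i *: x i.

Lemma represents_widen (x : nat -> V) (a : nat -> R) n m : (n <= m)%N ->
  (forall i, (n <= i)%N -> a i = 0) ->
  \sum_(0 <= i < n) a i *: x i = \sum_(0 <= i < m) a i *: x i.
Proof.
move=> nm a0; rewrite (big_cat_nat (leq0n n) nm) /= [X in _ + X]big1_seq ?addr0 // => i.
by rewrite mem_index_iota => /andP[_ /andP[ni _]]; rewrite a0 // scale0r.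
Qed.

Lemma represents0 (x : nat -> V) : represents x (fun=> 0) 0.
Proof. by exists 0%N; split=> //; rewrite big_geq. Qed.

Lemma represents_linear (x : nat -> V) (a b : nat -> R) c u v :
  represents x a u -> represents x b v ->
  represents x (fun i => c * a i + b i) (c *: u + v).
Proof.
move=> [n [a0 ->]] [m [b0 ->]]; exists (maxn n m); split=> [i|].
  by rewrite geq_max => /andP[ni mi]; rewrite a0 // b0 // mulr0 addr0.
rewrite (represents_widen _ (leq_maxl n m) a0) (represents_widen _ (leq_maxr n m) b0).
rewrite scaler_sumr -big_split /=; apply: eq_bigr => i _.
by rewrite scalerDl scalerA.
Qed.

Lemma represents_delta (x : nat -> V) m : represents x (fun i => (i == m)%:R) (x m).
Proof.
exists m.+1; split=> [i im|]; first by rewrite gtn_eqF.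
rewrite big_nat_recr //= eqxx scale1r big1_seq ?add0r // => i.
by rewrite mem_index_iota => /andP[_ /andP[_ im]]; rewrite ltn_eqF // scale0r.
Qed.

Lemma functional1_sum (phi : functional1 (V := V)) (x : nat -> V) (a : nat -> R) n m :
  sval phi (\sum_(n <= i < m) a i *: x i) = \sum_(n <= i < m) a i * sval phi (x i).
Proof.
elim/big_ind2 : _ => [|u c v d <- <-|i _].
- by have := functional1B phi 0 0; rewrite subrr; lra.
- by have := (svalP phi).1 1 c d; rewrite scale1r mul1r.
- have := (svalP phi).1 (a i) (x i) 0; rewrite addr0 => ->.
  by have := functional1B phi 0 0; rewrite subrr; lra.
Qed.

Lemma sum_pow2 n : \sum_(0 <= i < n) 2 ^+ i = 2 ^+ n - 1 :> R.
Proof.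
elim: n => [|n IH]; first by rewrite big_geq // expr0 subrr.
by rewrite big_nat_recr //= IH exprS; lra.
Qed.

(** Applying [phi k] isolates [a k] up to the terms of smaller index, and
    [1 + 1 + 2 + ... + 2 ^ (k - 1) = 2 ^ k]. *)
Lemma triangular_coef (x : nat -> V) (a : nat -> R) v k :
  triangular x -> represents x a v -> `|a k| <= 2 ^+ k * `|v|.
Proof.
move=> [x1 [phi [phi1 phi0]]] [n [a0 vE]].
elim/ltn_ind: k => k IH.
have [kn|nk] := ltnP k n; last by rewrite a0 // normr0 mulr_ge0 // exprn_ge0.
have : sval (phi k) v = \sum_(0 <= i < k) a i * sval (phi k) (x i) + a k.
  rewrite vE functional1_sum (big_cat_nat (leq0n k) (ltnW kn)) /= [X in _ + X]big_ltn //.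
  rewrite phi1 mulr1 [X in _ + (_ + X)]big1_seq ?addr0 // => i.
  by rewrite mem_index_iota => /andP[_ /andP[ki _]]; rewrite phi0 // mulr0.
move=> phiv.
have -> : a k = sval (phi k) v - \sum_(0 <= i < k) a i * sval (phi k) (x i).
  by rewrite phiv; lra.
apply: le_trans (ler_normB _ _) _.
have h1 : `|sval (phi k) v| <= `|v| by exact: (svalP (phi k)).2.
suff : `|\sum_(0 <= i < k) a i * sval (phi k) (x i)| <= (2 ^+ k - 1) * `|v| by lra.
apply: le_trans (ler_norm_sum _ _ _) _.
rewrite -sum_pow2 mulr_suml !big_seq ler_sum // => i.
rewrite mem_index_iota => /andP[_ ik]; rewrite normrM.
have phix : `|sval (phi k) (x i)| <= 1.
  by apply: le_trans ((svalP (phi k)).2 _) _; rewrite x1.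
by rewrite -[leRHS]mulr1 ler_pM // IH.
Qed.

Lemma triangular_subseq (x : nat -> V) (g : nat -> nat) :
  (forall i j, (i < j)%N -> (g i < g j)%N) -> triangular x -> triangular (x \o g).
Proof.
move=> hg [x1 [phi [phi1 phi0]]]; split=> [k|]; first exact: x1.
by exists (phi \o g); split=> [k|k i ki]; [exact: phi1|apply: phi0; exact: hg].
Qed.

(** A row vector in the kernel of the matrix of coordinates would be a linear
    relation between the terms of the sequence. *)
Lemma triangular_not_finite_dimensional (x : nat -> V) N :
  triangular x -> (forall i, N (x i)) -> ~ finite_dimensional N.
Proof.
move=> tx Nx [n [e [_ he]]].
have /choice[A hA] i : exists a : 'I_n -> R, x i = \sum_(j < n) a j *: e j by exact: he.
pose M : 'M[R]_(n.+1, n) := \matrix_(i, j) A i j.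
have : kermx M != 0.
  apply/eqP => k0; have := mxrank_ker M; rewrite k0 mxrank0 => /esym/eqP.
  by rewrite subn_eq0 leqNgt ltnS rank_leq_col.
move=> /rowV0Pn[r /sub_kermxP rM /eqP]; apply; apply/rowP => k; rewrite mxE.
pose a i := if insub i is Some j then r 0 j else 0.
have aE (j : 'I_n.+1) : a j = r 0 j by rewrite /a valK.
have rep0 : represents x a 0.
  exists n.+1; split=> [i ni|]; first by rewrite /a insubF // ltnNge ni.
  rewrite big_mkord; under eq_bigr do rewrite aE hA scaler_sumr.
  rewrite exchange_big /=; apply/esym/big1 => j _.
  under eq_bigr do rewrite scalerA.
  rewrite -scaler_suml; have /rowP/(_ j) := rM; rewrite !mxE.
  under eq_bigr do rewrite mxE.
  by move=> ->; rewrite scale0r.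
have := triangular_coef k tx rep0; rewrite normr0 mulr0 normr_le0 aE => /eqP ->.
by [].
Qed.

Definition span_on (x : nat -> V) (P : pred nat) : set V :=
  [set v | exists2 a, represents x a v & forall i, ~~ P i -> a i = 0].

Lemma span_on_linear x P : linear_subset (span_on x P).
Proof.
split=> [|c u v [a ua a0] [b vb b0]]; first by exists (fun=> 0) => //; exact: represents0.
exists (fun i => c * a i + b i); first exact: represents_linear.
by move=> i Pi; rewrite a0 // b0 // mulr0 addr0.
Qed.

Lemma span_on_mem x (P : pred nat) i : P i -> span_on x P (x i).
Proof.
move=> Pi; exists (fun j => (j == i)%:R); first exact: represents_delta.
by move=> j; have [->|//] := eqVneq j i; rewrite Pi.
Qed.

Lemma closure_normP N v :
  closure N v <-> forall e, 0 < e -> exists2 w, N w & `|v - w| < e.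
Proof.
split=> [h e e0|h B /nbhs_ballP[e /= e0 eB]].
  have [w [Nw vw]] := h _ (nbhsx_ballx v e e0).
  by exists w => //; move: vw; rewrite -ball_normE.
have [w Nw vw] := h e e0; exists w; split=> //.
by apply: eB; rewrite -ball_normE.
Qed.

Lemma closure_linear N : linear_subset N -> linear_subset (closure N).
Proof.
move=> [N0 hN]; split=> [|c u v /closure_normP hu /closure_normP hv].
  exact: subset_closure.
apply/closure_normP => e e0.
have c0 : 0 < 1 + `|c| by rewrite ltr_pwDl.
have [u' Nu' uu'] := hu (e / (2 * (1 + `|c|))) (divr_gt0 e0 (mulr_gt0 (ltr0n _ 2) c0)).
have [v' Nv' vv'] := hv (e / 2) (divr_gt0 e0 (ltr0n _ 2)).
exists (c *: u' + v'); first exact: hN.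
have -> : c *: u + v - (c *: u' + v') = c *: (u - u') + (v - v') by vector_ring.
apply: le_lt_trans (ler_normD _ _) _; rewrite normrZ.
have : `|c| * `|u - u'| <= (1 + `|c|) * `|u - u'| by rewrite ler_wpM2r //; lra.
move: uu'; rewrite invfM mulrA ltr_pdivlMr //; lra.
Qed.

Lemma linear_subset_submod_closed N : linear_subset N -> submod_closed [in N].
Proof.
move=> [N0 hN]; split=> [|c u v Nu Nv]; apply/mem_set => //.
by apply: hN; exact: set_mem.
Qed.

Lemma triangular_exists (S : V -> V) (e : nat -> R) :
  (forall k, 0 < e k) ->
  (forall s d, 0 < d -> exists v, [/\ common_kernel s v, `|v| = 1 & `|S v| <= d]) ->
  exists2 x, triangular x & forall k, `|S (x k)| <= e k.
Proof.
move=> e0 hS.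
have /choice[next hnext] s : exists p : V * functional1,
    [/\ common_kernel s p.1, `|p.1| = 1, `|S p.1| <= e (size s) & sval p.2 p.1 = 1].
  have [v [sv v1 Sv]] := hS s _ (e0 (size s)).
  have [phi hphi phiv] := norming_functional v.
  by exists (v, exist _ phi hphi); split=> //=; rewrite phiv.
pose st := fix st n := if n is n'.+1 then (next (st n')).2 :: st n' else [::].
have size_st n : size (st n) = n by elim: n => //= n ->.
exists (fun n => (next (st n)).1) => [|k].
  split=> [k|]; first by have [] := hnext (st k).
  exists (fun n => (next (st n)).2); split=> [k|k i ki]; first by have [] := hnext (st k).
  have sub : common_kernel (st i) `<=` [set v | sval (next (st k)).2 v = 0].
    elim: i ki => // i IH; rewrite ltnS leq_eqVlt => /orP[/eqP <- v []//|ki].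
    by move=> v [/(IH ki)].
  by apply: sub; have [] := hnext (st i).
by have [_ _] := hnext (st k); rewrite size_st.
Qed.

(** Sizes [e * 2 ^ - (2 k + 1)] for the values on the sequence are summable
    against the coefficient bounds [2 ^ k]. *)
Lemma small_on_subspace (S : {linear V -> V}) L e : 0 < L -> 0 < e ->
  (forall v, `|S v| <= L * `|v|) ->
  (forall s d, 0 < d -> exists v, [/\ common_kernel s v, `|v| = 1 & `|S v| <= d]) ->
  exists N, [/\ linear_subset N, closed N, ~ finite_dimensional N &
    forall v, N v -> `|S v| <= e * `|v|].
Proof.
move=> L0 e0 hL hS.
have [|x tx Sx] := @triangular_exists S (fun k => e * (2^-1 ^+ k * 2^-1 ^+ k.+1)) _ hS.
  by move=> k; rewrite !mulr_gt0 // exprn_gt0.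
exists (closure (span_on x predT)); split.
- exact: closure_linear (span_on_linear _ _).
- exact: closed_closure.
- apply: (triangular_not_finite_dimensional tx) => i.
  by apply: subset_closure; exact: span_on_mem.
have small w : span_on x predT w -> `|S w| <= e * `|w|.
  move=> [a aw _]; have [n [_ wE]] := aw.
  rewrite [in S w]wE linear_sum /=; apply: le_trans (ler_norm_sum _ _ _) _.
  have geo : \sum_(0 <= i < n) 2^-1 ^+ i.+1 <= 1 :> R.
    suff -> : \sum_(0 <= i < n) 2^-1 ^+ i.+1 = 1 - 2^-1 ^+ n :> R.
      by have : 0 <= 2^-1 ^+ n :> R by []; lra.
    elim: (n) => [|k IH]; first by rewrite big_geq // expr0 subrr.
    by rewrite big_nat_recr //= IH exprS; lra.
  rewrite -[leRHS]mul1r; apply: le_trans (ler_wpM2r _ geo); last first.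
    by rewrite mulr_ge0 // ltW.
  rewrite mulr_suml ler_sum // => i _; rewrite linearZ /= normrZ.
  apply: le_trans (ler_pM _ _ (triangular_coef i tx aw) (Sx i)) _ => //.
  have h2 : 2 ^+ i * 2^-1 ^+ i = 1 :> R by rewrite -exprMn divff // expr1n.
  have -> : 2 ^+ i * `|w| * (e * (2^-1 ^+ i * 2^-1 ^+ i.+1)) =
    (2 ^+ i * 2^-1 ^+ i) * (2^-1 ^+ i.+1 * (e * `|w|)) by ring.
  by rewrite h2 mul1r.
move=> v /closure_normP hv; apply/ler_addgt0Pr => d d0.
have Le : 0 < L + e by lra.
have [w sw vw] := hv _ (divr_gt0 d0 Le).
have -> : S v = S (v - w) + S w by rewrite -linearD subrK.
apply: le_trans (ler_normD _ _) _.
have := hL (v - w); have := small _ sw.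
have : e * `|w| <= e * (`|v| + `|v - w|).
  rewrite ler_pM2l //; have := ler_normB v (v - w).
  by rewrite opprB addrC subrK.
by move: vw; rewrite ltr_pdivlMr //; lra.
Qed.

(** Riesz's lemma. *)
Lemma almost_orthogonal_unit N y d : linear_subset N -> 0 < d ->
  (forall u, N u -> d <= `|y - u|) ->
  exists w, [/\ `|w| = 1, exists a u, N u /\ w = a *: (y - u) &
    forall u, N u -> 1 / 2 <= `|w - u|].
Proof.
move=> hN d0 hd.
pose E := [set `|y - u| | u in N].
have E0 : E !=set0 by exists `|y - 0|, 0 => //; exact: hN.1.
have Elb : lbound E d by move=> _ [u Nu <-]; exact: hd.
have dE : d <= inf E by exact: lb_le_inf.
have [|_ [u Nu <-] hu] := @inf_adherent _ E (inf E) (lt_le_trans d0 dE).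
  by split=> //; exists d.
have yu0 : 0 < `|y - u| by apply: lt_le_trans d0 (hd _ Nu).
exists (`|y - u|^-1 *: (y - u)); split.
- by rewrite normrZ gtr0_norm ?invr_gt0 // mulVf // gt_eqF.
- by exists `|y - u|^-1, u.
move=> v Nv.
have -> : `|y - u|^-1 *: (y - u) - v = `|y - u|^-1 *: (y - (u + `|y - u| *: v)).
  rewrite opprD addrA [RHS]scalerBr; congr (_ - _).
  by rewrite scalerA mulVf ?scale1r // gt_eqF.
rewrite normrZ gtr0_norm ?invr_gt0 // ler_pdivlMl //.
have : inf E <= `|y - (u + `|y - u| *: v)|.
  apply: ge_inf; first by exists d.
  exists (u + `|y - u| *: v) => //.
  by apply: linear_subsetD => //; exact: linear_subsetZ.
lra.
Qed.

(** The closed span of the terms of even index misses, one after the other, all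
    the terms of odd index; Riesz's lemma makes them uniformly separated. *)
Lemma even_span_infinite_codimension (x : nat -> V) : triangular x ->
  ~ ball_tot_bounded_mod (1 / 2) (closure (span_on x (fun i => ~~ odd i))).
Proof.
move=> tx; set N := closure _.
have hN : linear_subset N by exact: closure_linear (span_on_linear _ _).
move=> /(ball_tot_bounded_mod_half hN)[T [chi h]].
(* [U k] contains the even terms, the earlier odd terms, and hence [w j] for
   [j < k]; so [w k - w j] stays at distance [1 / 2] from the even span. *)
pose U k := span_on x (fun i => ~~ odd i || (i < k.*2.+1)%N).
have UL k : linear_subset (U k) by exact: span_on_linear.
have /choice[w hw] k : exists w, [/\ `|w| = 1,
    exists a u, U k u /\ w = a *: (x k.*2.+1 - u) &
    forall u, U k u -> 1 / 2 <= `|w - u|].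
  apply: (@almost_orthogonal_unit _ _ (2 ^- k.*2.+1)) => //.
  move=> u [a ua a0]; rewrite -[leLHS]mul1r ler_pdivrMr ?exprn_gt0 // mulrC.
  have := triangular_coef k.*2.+1 tx (represents_linear (-1) ua (represents_delta x k.*2.+1)).
  by rewrite eqxx a0 ?mulr0 ?add0r ?normr1 ?scaleN1r ?[- u + _]addrC //= odd_double ltnn.
have wU j k : (j < k)%N -> U k (w j).
  move=> jk; have [_ [a [u [[b ub b0] ->]]] _] := hw j.
  apply: linear_subsetZ => //; apply: linear_subsetB => //.
    apply: span_on_mem; rewrite ltnS -[(j.*2 < k.*2)%N]/(j.*2.+1 <= k.*2)%N.
    by rewrite ltn_double jk orbT.
  exists b => // i; rewrite negb_or => /andP[oi ki]; apply: b0.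
  rewrite negb_or oi /=; apply: contraNN ki => ij.
  by apply: leq_trans ij _; rewrite !ltnS leq_double ltnW.
have sep j k : (j < k)%N -> chi (w j) <> chi (w k).
  move=> jk /esym cjk.
  have [wk _ hk] := hw k; have [wj _ _] := hw j.
  have [|| v /closure_normP/(_ (1 / 4)) []] := h _ _ _ _ cjk; rewrite ?wk ?wj //.
  move=> v' [a va a0] vv' hv.
  have : U k (w j + v').
    apply: linear_subsetD => //; first exact: wU.
    by exists a => // i; rewrite negb_or => /andP[oi _]; exact: a0.
  move=> /hk; have -> : w k - (w j + v') = (w k - w j - v) + (v - v') by vector_ring.
  by have := ler_normD (w k - w j - v) (v - v'); lra.
have : injective (fun j : 'I_#|T|.+1 => chi (w j)).
  move=> j k /= e; apply/val_inj/eqP; case: ltngtP => // /sep; rewrite e //.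
by move=> /leq_card; rewrite card_ord ltnn.
Qed.

End TriangularSequences.

(** * A minimal space contains its square *)

Section MinimalSquare.
Context {R : realType} {Y : normedModType R}.

(** Applying [T - mu'] to [z + z'] nearly kills [z'] and nearly multiplies [z]
    by [mu - mu']; this recovers [z], and likewise [z'], from [z + z']. *)
Lemma nearly_scalar_subspaces_separated (T : {linear Y -> Y}) C mu mu' (N N' : set Y) :
  mu < mu' -> 0 < C -> (forall v, `|T v| <= C * `|v|) ->
  (forall z, N z -> `|T z - mu *: z| <= (mu' - mu) / 4 * `|z|) ->
  (forall z, N' z -> `|T z - mu' *: z| <= (mu' - mu) / 4 * `|z|) ->
  exists2 k, 0 < k & forall z z', N z -> N' z' -> k * (`|z| + `|z'|) <= `|z + z'|.
Proof.
move=> mm C0 hC hN hN'.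
pose K := 2 * C + `|mu| + `|mu'|.
have K0 : 0 < K by rewrite /K; have := normr_ge0 mu; have := normr_ge0 mu'; lra.
have D0 : 0 < mu' - mu by lra.
exists ((mu' - mu) / (2 * K)) => [|z z' Nz Nz']; first by rewrite divr_gt0 // mulr_gt0.
have e1 : (mu' - mu) *: z =
    (T z - mu *: z) + (T z' - mu' *: z') - (T (z + z') - mu' *: (z + z')).
  by rewrite (linearD T); vector_ring.
have e2 : (mu' - mu) *: z' =
    (T (z + z') - mu *: (z + z')) - (T z - mu *: z) - (T z' - mu' *: z').
  by rewrite (linearD T); vector_ring.
have h1 := hN _ Nz; have h2 := hN' _ Nz'; have h3 := hC (z + z').
have n1 := ler_normB (T (z + z')) (mu' *: (z + z')).
have n2 := ler_normB (T (z + z')) (mu *: (z + z')).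
move: n1 n2; rewrite !normrZ => n1 n2.
have := congr1 Num.norm e1; have := congr1 Num.norm e2; rewrite !normrZ (gtr0_norm D0).
have := ler_normB ((T z - mu *: z) + (T z' - mu' *: z')) (T (z + z') - mu' *: (z + z')).
have := ler_normD (T z - mu *: z) (T z' - mu' *: z').
have := ler_normB ((T (z + z') - mu *: (z + z')) - (T z - mu *: z)) (T z' - mu' *: z').
have := ler_normB (T (z + z') - mu *: (z + z')) (T z - mu *: z).
move=> i1 i2 i3 i4 E2 E1.
rewrite mulrAC ler_pdivrMr ?mulr_gt0 //.
move: i1 i2 i3 i4; rewrite -/K => i1 i2 i3 i4.
have : (mu' - mu) * (`|z| + `|z'|) <= 2 * (K * `|z + z'|) by rewrite /K; lra.
lra.
Qed.

(** Minimality is used three times.  An embedding of [Y] onto a subspace of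
    infinite codimension is nearly a negative scalar on one infinite
    dimensional subspace and nearly a positive scalar on another; such
    subspaces form a direct sum, and both contain copies of [Y]. *)
Lemma minimal_square : minimal_space Y ->
  exists (T1 T2 : {linear Y -> Y}) (L : R), [/\ 0 < L,
    forall a, `|T1 a| <= L * `|a|, forall a, `|T2 a| <= L * `|a| &
    forall a b, `|a| + `|b| <= `|T1 a + T2 b|].
Proof.
move=> [infY minY].
have [|s d d0|x tx _] := @triangular_exists _ Y (fun=> 0) (fun=> 1).
- by move=> _.
- have [v sv v0] := common_kernel_neq0 s infY.
  exists (`|v|^-1 *: v); split.
  + exact: linear_subsetZ (common_kernel_linear s) sv.
  + by rewrite normrZ normfV normr_id mulVf // normr_eq0.
  + by rewrite normr0 ltW.
have minN N : linear_subset N -> closed N -> ~ finite_dimensional N ->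
    exists T : {linear Y -> Y}, isomorphic_embedding T /\ range T `<=` N.
  by move=> hN; apply: minY; exact: linear_subset_submod_closed.
have [||| T [[c [C [c0 C0 hT]]] rT]] := minN (closure (span_on x (fun i => ~~ odd i))).
- exact: closure_linear (span_on_linear _ _).
- exact: closed_closure.
- apply: (@triangular_not_finite_dimensional _ _ (x \o double)).
    by apply: triangular_subseq tx => i j; rewrite ltn_double.
  by move=> i; apply: subset_closure; apply: span_on_mem; rewrite odd_double.
have infT : ~ ball_tot_bounded_mod (1 / 2) (range T).
  by move=> /(ball_tot_bounded_mod_sub rT); exact: even_span_infinite_codimension.
have [|mu mu0 hmu] := @approximate_eigenvectors _ _ 1 T c C _ c0 C0 hT infT.
  by rewrite normr1.
have [|mu' mu'0 hmu'] := @approximate_eigenvectors _ _ (-1) T c C _ c0 C0 hT infT.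
  by rewrite normrN1.
have mm : mu < mu' by lra.
have D4 : 0 < (mu' - mu) / 4 by lra.
have bound m v : `|T v - m *: v| <= (C + `|m|) * `|v|.
  apply: le_trans (ler_normB _ _) _; rewrite normrZ mulrDl.
  by have [_] := hT v; lra.
have Cm (m : R) : 0 < C + `|m| by have := normr_ge0 m; lra.
have [N [linN clN infN hN]] :=
  @small_on_subspace _ _ (T \- (mu \*: idfun)) _ _ (Cm mu) D4 (bound mu) hmu.
have [N' [linN' clN' infN' hN']] :=
  @small_on_subspace _ _ (T \- (mu' \*: idfun)) _ _ (Cm mu') D4 (bound mu') hmu'.
have [|k k0 hk] := nearly_scalar_subspaces_separated mm C0 _ hN hN'.
  by move=> v; have [] := hT v.
have [A [[a [a' [a0 a'0 hA]]] rA]] := minN _ linN clN infN.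
have [B [[b [b' [b0 b'0 hB]]] rB]] := minN _ linN' clN' infN'.
pose q := k * Num.min a b.
have q0 : 0 < q by rewrite mulr_gt0 // lt_min a0.
have qV : 0 < q^-1 by rewrite invr_gt0.
exists (q^-1 \*: A), (q^-1 \*: B), (q^-1 * (a' + b')); split.
- by rewrite mulr_gt0 // addr_gt0.
- move=> v /=; rewrite normrZ gtr0_norm // -mulrA ler_pM2l //.
  by have [_] := hA v; have := mulr_ge0 (ltW b'0) (normr_ge0 v); lra.
- move=> v /=; rewrite normrZ gtr0_norm // -mulrA ler_pM2l //.
  by have [_] := hB v; have := mulr_ge0 (ltW a'0) (normr_ge0 v); lra.
move=> u v /=; rewrite -scalerDr normrZ gtr0_norm // ler_pdivlMl //.
have /hk /(_ _) : N (A u) by apply: rA; exists u.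
have N'B : N' (B v) by apply: rB; exists v.
move=> /(_ _ N'B); apply: le_trans.
rewrite /q -mulrA ler_pM2l // mulrDr.
have [hAu _] := hA u; have [hBv _] := hB v.
have : Num.min a b * `|u| <= a * `|u| by rewrite ler_wpM2r // ge_min lexx.
have : Num.min a b * `|v| <= b * `|v| by rewrite ler_wpM2r // ge_min lexx orbT.
lra.
Qed.

End MinimalSquare.

(** * Superposition of maps *)

Section Superposition.
Context {R : realType} {Y : completeNormedModType R}.
Variables (T1 T2 : {linear Y -> Y}) (L : R).
Hypotheses (L0 : 0 < L) (T1L : forall a, `|T1 a| <= L * `|a|)
  (T2L : forall a, `|T2 a| <= L * `|a|)
  (T12 : forall a b, `|a| + `|b| <= `|T1 a + T2 b|).

Let shift n a := iter n T2 (T1 a).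

Lemma shift_bound n a : `|shift n a| <= L ^+ n.+1 * `|a|.
Proof.
elim: n => [|n IH]; first by rewrite expr1; exact: T1L.
by apply: le_trans (T2L _) _; rewrite exprS -mulrA ler_pM2l.
Qed.

Lemma shiftB n a b : shift n (a - b) = shift n a - shift n b.
Proof. 
elim: n => [|n IH]; first exact: linearB.
by apply: etrans (congr1 T2 IH) _; rewrite linearB. Qed.

Lemma shift_sum_ge n (a : nat -> Y) k : (k < n)%N ->
  `|a k| <= `|\sum_(0 <= i < n) shift i (a i)|.
Proof.
elim: n a k => // n IH a k kn; rewrite big_nat_recl //=.
have -> : \sum_(0 <= i < n) shift i.+1 (a i.+1) = T2 (\sum_(0 <= i < n) shift i (a i.+1)).
  by rewrite linear_sum.
apply: le_trans (T12 _ _); case: k kn => [|k] kn; first by rewrite lerDl.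
by apply: le_trans (IH (fun i => a i.+1) k kn) _; rewrite lerDr.
Qed.

Lemma sum_half_pow N n : \sum_(N <= i < n) 2^-1 ^+ i <= 2 * 2^-1 ^+ N :> R.
Proof.
have p m : 0 <= 2^-1 ^+ m :> R by [].
have [nN|Nn] := leqP n N; first by rewrite big_geq //; have := p N; lra.
suff -> : \sum_(N <= i < n) 2^-1 ^+ i = 2 * 2^-1 ^+ N - 2 * 2^-1 ^+ n :> R.
  by have := p n; lra.
elim: n Nn => // n IH; rewrite ltnS leq_eqVlt => /orP[/eqP <-|Nn].
  by rewrite big_nat1 exprS; lra.
by rewrite big_nat_recr 1?ltnW //= IH // exprS; lra.
Qed.

(** The operators [iter n T2 \o T1] send [Y] onto the terms of a
    decomposition whose coordinate maps do not increase norms; the sum is at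
    least as far apart as each of its terms, and no later term can cancel an
    earlier one. *)
Lemma superposition (X : Type) (f : nat -> X -> Y) :
  (forall x, exists N, forall n, (N <= n)%N -> L ^+ n.+1 * `|f n x| <= 2^-1 ^+ n) ->
  exists F : X -> Y,
    (forall n x y, `|f n x - f n y| <= `|F x - F y|) /\
    (forall N x y,
      (forall n, (N <= n)%N -> L ^+ n.+1 * `|f n x - f n y| <= 2^-1 ^+ n) ->
      `|F x - F y| <=
        \sum_(0 <= n < N) L ^+ n.+1 * `|f n x - f n y| + 2 * 2^-1 ^+ N).
Proof.
move=> hf.
pose u x n := shift n (f n x).
have tail (g : nat -> Y) N n : (forall n, (N <= n)%N -> L ^+ n.+1 * `|g n| <= 2^-1 ^+ n) ->
    \sum_(0 <= i < n) `|shift i (g i)| <=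
    \sum_(0 <= i < N) L ^+ i.+1 * `|g i| + 2 * 2^-1 ^+ N.
  move=> hg.
  apply: (@le_trans _ _ (\sum_(0 <= i < maxn N n) `|shift i (g i)|)).
    rewrite [leRHS](big_cat_nat (leq0n n) (leq_maxr N n)) /= lerDl.
    by rewrite sumr_ge0.
  rewrite (big_cat_nat (leq0n N) (leq_maxl N n)) /=; apply: lerD.
    by apply: ler_sum => i _; exact: shift_bound.
  apply: le_trans (sum_half_pow N (maxn N n)).
  rewrite !big_seq; apply: ler_sum => i; rewrite mem_index_iota => /andP[Ni _].
  exact: le_trans (shift_bound _ _) (hg _ Ni).
have cv x : cvgn (series (u x)).
  apply: normed_cvg; have [N hN] := hf x.
  apply: nondecreasing_is_cvgn.
    by apply: nondecreasing_series => n _ _; exact: normr_ge0.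
  by eexists => _ [n _ <-]; exact: tail hN.
exists (fun x => limn (series (u x))).
have lim x y : `|series (u x) n - series (u y) n| @[n --> \oo] -->
    `|limn (series (u x)) - limn (series (u y))|.
  by apply: cvg_norm; apply: cvgB; exact: cv.
have dE x y n : series (u x) n - series (u y) n =
    \sum_(0 <= i < n) shift i (f i x - f i y).
  by rewrite /series /= -sumrB; apply: eq_bigr => i _; rewrite shiftB.
split=> [n x y|N x y h].
  apply: (cvgr_to_ge (lim x y)); near=> m.
  by rewrite dE; apply: (shift_sum_ge (fun i => f i x - f i y)); near: m; exists n.+1.
apply: (cvgr_to_le (lim x y)); near=> m.
by rewrite dE; apply: le_trans (ler_norm_sum _ _ _) _; exact: tail h.
Unshelve. all: by end_near.
Qed.

End Superposition.

(** * Continuous maps close to coarse maps *)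

Section ContinuousApproximation.
Context {R : realType}.

(** The strict part of a well-order, reduced to the two properties that the
    construction of the weights needs. *)
Lemma well_founded_total_relation (X : eqType) : exists lt : X -> X -> Prop,
  (forall a b, a <> b -> lt a b \/ lt b a) /\
  (forall A : set X, A !=set0 -> exists a, A a /\ forall b, lt b a -> ~ A b).
Proof.
have [le hle] := well_ordering_principle X.
have min_of (A : {pred X}) a : a \in A ->
    exists2 z, minimum_of le A z & forall z', minimum_of le A z' -> z = z'.
  by move=> Aa; have [|z [h1 h2]] := hle A; [exists a|exists z].
have refl a : le a a.
  have [|z [za lz] _] := min_of (pred1 a) a; first by rewrite inE.
  by have := lz a; rewrite inE eqxx => /(_ isT); move: za; rewrite inE => /eqP ->.
exists (fun a b => ~ le b a); split=> [a b ab|A [x Ax]].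
  apply/not_andP => -[ba ab']; apply: ab.
  have [|z _ uz] := min_of (pred2 a b) a; first by rewrite inE eqxx.
  rewrite -(uz a) ?(uz b) //; split; rewrite ?inE ?eqxx ?orbT // => c;
    by rewrite inE => /orP[] /eqP ->.
have [|z [Az lz] _] := min_of [in A] x; first exact: mem_set.
exists z; split=> [|b nzb Ab]; first exact: set_mem.
by apply: nzb; apply: lz; exact: mem_set.
Qed.

Variable X : normedModType R.
Implicit Types (a b x y : X).

(** After normalisation, the weights form a partition of unity subordinate to
    the balls of radius one.  Along a well-order, [record a x] is the amount by
    which [bump a x] exceeds all earlier bumps.  Two records larger than [e] at
    the same point come from bumps that differ by more than [e], so there are
    finitely many of them; cutting at half of the largest record makes the
    family locally finite, even if [X] is not separable. *)
Lemma locally_finite_weights : exists q : X -> X -> R, [/\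
  forall a x, 0 <= q a x, forall a, continuous (q a),
  forall a x, 1 <= `|x - a| -> q a x = 0,
  forall x, exists a, 0 < q a x &
  forall x, exists A : {fset X}, \forall y \near x, forall a, a \notin A -> q a y = 0].
Proof.
have [lt [lt_total lt_wf]] := well_founded_total_relation X.
pose bump a x := Num.max 0 (1 - `|x - a|).
pose earlier a x := [set r | r = 0 \/ exists2 b, lt b a & r = bump b x].
pose record a x := Num.max 0 (bump a x - sup (earlier a x)).
have bump_ge0 a x : 0 <= bump a x by rewrite le_max lexx.
have bump_le1 a x : bump a x <= 1.
  by rewrite ge_max ler01 /=; have := normr_ge0 (x - a); lra.
have bump_lip a x y : bump a x <= bump a y + `|x - y|.
  rewrite ge_max; apply/andP; split; first by rewrite addr_ge0.
  have : 1 - `|y - a| <= bump a y by rewrite le_max lexx orbT.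
  by have := ler_distD x y a; rewrite (distrC y x); lra.
have early_sup a x : has_sup (earlier a x).
  split; first by exists 0; left.
  by exists 1 => r [->|[b _ ->]].
have early_ge0 a x : 0 <= sup (earlier a x).
  by apply: (ub_le_sup (early_sup a x).2); left.
have early_ge a b x : lt b a -> bump b x <= sup (earlier a x).
  by move=> ba; apply: (ub_le_sup (early_sup a x).2); right; exists b.
have early_lip a x y : sup (earlier a x) <= sup (earlier a y) + `|x - y|.
  apply: (ge_sup (early_sup a x).1) => r [->|[b ba ->]].
    by rewrite addr_ge0.
  by apply: le_trans (bump_lip b x y) _; rewrite lerD2r; exact: early_ge.
have record_ge0 a x : 0 <= record a x by rewrite le_max lexx.
have record_le a x : record a x <= bump a x.
  by rewrite ge_max bump_ge0 /=; have := early_ge0 a x; lra.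
have record_lip a x y : record a x <= record a y + 2 * `|x - y|.
  rewrite ge_max; apply/andP; split; first by rewrite addr_ge0 // mulr_ge0.
  have : bump a y - sup (earlier a y) <= record a y by rewrite le_max lexx orbT.
  by have := bump_lip a x y; have := early_lip a y x; rewrite (distrC y x); lra.
have record_gt0 x : exists a, 0 < record a x.
  have [|a [ax hb]] := lt_wf [set a | 0 < bump a x].
    by exists x; rewrite /= /bump subrr normr0 subr0 lt_max ltr01 orbT.
  exists a; rewrite /record lt_max; apply/orP; right; rewrite subr_gt0.
  apply: le_lt_trans ax; apply: (ge_sup (early_sup a x).1) => r [->//|[b ba ->]].
  by rewrite leNgt; apply/negP; exact: hb.
have record_fin e x : 0 < e -> finite_set [set a | e < record a x].
  move=> e0; pose c a := Num.truncn (bump a x / e).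
  rewrite -(eq_finite_set (@inj_card_eq _ _ _ c _)); last first.
    suff h a b : e < record a x -> lt b a -> c a <> c b.
      move=> a b /set_mem ea /set_mem eb cab; apply: contrapT => ab.
      by have [l|l] := lt_total _ _ ab; [apply: h eb l _|apply: h ea l _].
    move=> ea ba cab; have := early_ge a b x ba.
    have : e < bump a x - sup (earlier a x).
      by move: ea; rewrite lt_max ltNge (ltW e0).
    have ge0 z : 0 <= bump z x / e by rewrite divr_ge0 // ltW.
    have /andP[_] := truncn_itv (ge0 a); have /andP[+ _] := truncn_itv (ge0 b).
    rewrite -/(c a) -/(c b) cab -natr1 ler_pdivlMr // ltr_pdivrMr // mulrDl; lra.
  apply: (@sub_finite_set _ _ `I_(Num.truncn (1 / e)).+1) => // _ [a _ <-].
  by rewrite /= ltnS le_truncn // ler_pM2r ?invr_gt0.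
pose top x := sup (range (record^~ x)).
have top_sup x : has_sup (range (record^~ x)).
  split; first by exists (record 0 x), 0.
  by exists 1 => _ [a _ <-]; exact: le_trans (record_le a x) (bump_le1 a x).
have top_ge a x : record a x <= top x by apply: (ub_le_sup (top_sup x).2); exists a.
have top_gt0 x : 0 < top x.
  by have [a ax] := record_gt0 x; exact: lt_le_trans ax (top_ge a x).
have top_lip x y : top x <= top y + 2 * `|x - y|.
  apply: (ge_sup (top_sup x).1) => _ [a _ <-].
  by apply: le_trans (record_lip a x y) _; rewrite lerD2r.
pose q a x := Num.max 0 (record a x - top x / 2).
have q_ge0 a x : 0 <= q a x by rewrite le_max lexx.
have q_lip a x y : q a x <= q a y + 3 * `|x - y|.
  rewrite ge_max; apply/andP; split; first by rewrite addr_ge0 // mulr_ge0.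
  have : record a y - top y / 2 <= q a y by rewrite le_max lexx orbT.
  by have := record_lip a x y; have := top_lip y x; rewrite (distrC y x); lra.
exists q; split=> // [a x|a x xa|x|x].
- apply/cvgrPdist_le => e e0.
  apply/nbhs_ballP; exists (e / 3) => /=; first lra.
  move=> y; rewrite -ball_normE /= => xy.
  have := q_lip a x y; have := q_lip a y x; rewrite (distrC y x).
  by move=> h1 h2; rewrite ler_norml; apply/andP; split; lra.
- have b0 : bump a x = 0 by apply/max_idPl; lra.
  apply/max_idPl; have := record_le a x; rewrite b0; have := top_gt0 x; lra.
- have t2 : 0 < top x / 2 by have := top_gt0 x; lra.
  have [_ [a _ <-] ha] := sup_adherent t2 (top_sup x).
  by exists a; rewrite /q lt_max; apply/orP; right; rewrite -/(top x) in ha; lra.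
- have t4 : 0 < top x / 4 by have := top_gt0 x; lra.
  exists (fset_set [set a | top x / 4 < record a x]).
  apply/nbhs_ballP; exists (top x / 12) => /=; first by have := top_gt0 x; lra.
  move=> y; rewrite -ball_normE /= => xy a.
  rewrite in_fset_set; last exact: record_fin.
  move=> /negP ha; apply/max_idPl; rewrite leNgt; apply/negP => hq; apply: ha.
  apply/mem_set => /=; have := record_lip a y x; have := top_lip x y.
  by rewrite (distrC y x); lra.
Qed.

(** The approximation is the average of the values of [f] at the centres of the
    balls that contain [x], all of them within [C] of [f x]. *)
Lemma continuous_approximation (Y : normedModType R) (f : X -> Y) C :
  (forall x y, `|x - y| <= 1 -> `|f x - f y| <= C) ->
  exists2 g : X -> Y, continuous g & forall x, `|g x - f x| <= C.
Proof.
move=> hf; have [q [q0 qc qs qpos qfin]] := locally_finite_weights.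
pose g x := (\sum_(a \in [set: X]) q a x)^-1 *: \sum_(a \in [set: X]) q a x *: f a.
have gE (A : {fset X}) y : (forall a, a \notin A -> q a y = 0) ->
    g y = (\sum_(a <- A) q a y)^-1 *: \sum_(a <- A) q a y *: f a.
  move=> hA; rewrite /g (fsbigTE A) // (fsbigTE A) // => a /hA ->.
  by rewrite scale0r.
have sum_gt0 (A : {fset X}) y : (forall a, a \notin A -> q a y = 0) ->
    0 < \sum_(a <- A) q a y.
  move=> hA; have [a ay] := qpos y.
  have aA : a \in A by apply: contraT => /hA ay0; rewrite ay0 ltxx in ay.
  rewrite (big_rem a aA) /=; apply: lt_le_trans ay _.
  by rewrite lerDl sumr_ge0.
exists g => [x|x]; have [A hA] := qfin x.
  have hAx := nbhs_singleton hA.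
  rewrite /continuous_at (gE _ _ hAx).
  apply: cvg_trans; first apply: near_eq_cvg.
    by near=> y; apply/esym/gE; near: y; exact: hA.
  apply: cvgZ.
    apply: cvgV; first by rewrite gt_eqF // sum_gt0.
    by apply: cvg_big => [|a _]; [exact: add_continuous|exact: qc].
  apply: cvg_big => [|a _]; first exact: add_continuous.
  by apply: cvgZ; [exact: qc|exact: cvg_cst].
have hAx := nbhs_singleton hA; have S0 := sum_gt0 _ _ hAx.
rewrite (gE _ _ hAx); set S := \sum_(a <- A) q a x in S0 *.
have -> : S^-1 *: \sum_(a <- A) q a x *: f a - f x =
    S^-1 *: \sum_(a <- A) q a x *: (f a - f x).
  under [in RHS]eq_bigr do rewrite scalerBr.
  by rewrite sumrB -scaler_suml -/S scalerBr scalerA mulVf ?scale1r // gt_eqF.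
rewrite normrZ gtr0_norm ?invr_gt0 // ler_pdivrMl //.
apply: le_trans (ler_norm_sum _ _ _) _; rewrite mulr_suml ler_sum // => a _.
rewrite normrZ ger0_norm //.
have [xa|xa] := leP 1 `|x - a|; first by rewrite qs // !mul0r.
by rewrite ler_wpM2l // hf // distrC ltW.
Unshelve. all: by end_near.
Qed.

End ContinuousApproximation.

(** * Moduli *)

Section Moduli.
Context {R : realType} {M N : normedModType R}.
Implicit Type f : M -> N.

Lemma expansion_modulus_le f t (C : R) : (expansion_modulus f t <= C%:E)%E <->
  forall x y, `|x - y| <= t -> `|f x - f y| <= C.
Proof.
split=> [h x y xy|h].
  by rewrite -lee_fin; apply: le_trans h; apply: ereal_sup_ubound; exists (x, y).
by apply: ge_ereal_sup => _ [[x y] /= xy <-]; rewrite lee_fin; exact: h.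
Qed.

Lemma compression_modulus_ge f t (C : R) : (C%:E <= compression_modulus f t)%E <->
  forall x y, t <= `|x - y| -> C <= `|f x - f y|.
Proof.
split=> [h x y xy|h].
  by rewrite -lee_fin; apply: le_trans h _; apply: ereal_inf_lbound; exists (x, y).
by apply: le_ereal_inf_tmp => _ [[x y] /= xy <-]; rewrite lee_fin; exact: h.
Qed.

Lemma expansion_modulus_ge0 f t : 0 <= t -> (0 <= expansion_modulus f t)%E.
Proof.
move=> t0; apply: ereal_sup_ubound; exists (0, 0) => /=; by rewrite subrr normr0.
Qed.

Lemma coarseP f : coarse f <-> forall t, 0 <= t ->
  exists C, forall x y, `|x - y| <= t -> `|f x - f y| <= C.
Proof.
split=> h t t0.
  exists (fine (expansion_modulus f t)); apply/expansion_modulus_le.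
  rewrite fineK // ge0_fin_numE ?h //; exact: expansion_modulus_ge0.
have [C /expansion_modulus_le hC] := h t t0.
exact: le_lt_trans hC (ltry _).
Qed.

Lemma expandingP f : expanding f <-> forall C : R,
  exists t, forall x y, t <= `|x - y| -> C <= `|f x - f y|.
Proof.
split=> [/cvgeyPge h C|h].
  near (pinfty_nbhs R) => t; exists t; apply/compression_modulus_ge; near: t; exact: h.
apply/cvgeyPge => C; have [t ht] := h C.
near=> s; apply/compression_modulus_ge => x y xy; apply: ht.
by apply: le_trans xy; near: s; apply: nbhs_pinfty_ge; exact: num_real.
Unshelve. all: by end_near.
Qed.

Lemma uniform_embeddingP f : uniform_embedding f <->
  (forall e : R, 0 < e ->
    exists2 d, 0 < d & forall x y, `|x - y| <= d -> `|f x - f y| <= e) /\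
  (forall t : R, 0 < t ->
    exists2 c, 0 < c & forall x y, t <= `|x - y| -> c <= `|f x - f y|).
Proof.
have compP : (forall t : R, 0 < t -> (0 < compression_modulus f t)%E) <->
    forall t : R, 0 < t ->
    exists2 c, 0 < c & forall x y, t <= `|x - y| -> c <= `|f x - f y|.
  split=> h t t0; last first.
    have [c c0 /compression_modulus_ge] := h t t0.
    by apply: lt_le_trans; rewrite lte_fin.
  have := h t t0; case E : (compression_modulus f t) => [c| |] // c0.
    by exists c; [rewrite -lte_fin|apply/compression_modulus_ge; rewrite E].
  by exists 1 => //; apply/compression_modulus_ge; rewrite E leey.
rewrite /uniform_embedding compP; split=> -[h h']; split=> //.
  move: h => /fine_cvgP[hfin /cvgrPdist_le hcv] e e0.
  near (0 : R)^'+ => t; exists t; first by near: t; exact: nbhs_right_gt.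
  apply/expansion_modulus_le; rewrite -[leLHS]fineK; last by near: t; exact: hfin.
  rewrite lee_fin; apply: le_trans (ler_norm _) _; rewrite -normrN -sub0r.
  by near: t; exact: hcv.
have fin_near : \forall t \near 0^'+, expansion_modulus f t \is a fin_num.
  have [d d0 hd] := h 1 ltr01.
  near=> t; rewrite ge0_fin_numE; last first.
    by apply: expansion_modulus_ge0; near: t; exact: nbhs_right_ge.
  apply: (@le_lt_trans _ _ 1%:E); last exact: ltry.
  apply/expansion_modulus_le => x y xy; apply: hd; apply: le_trans xy _.
  by near: t; exact: nbhs_right_le.
apply/fine_cvgP; split=> //; apply/cvgrPdist_le => e e0.
have [d d0 hd] := h e e0.
near=> t; rewrite sub0r normrN ger0_norm; last first.
  apply: fine_ge0; apply: expansion_modulus_ge0; near: t; exact: nbhs_right_ge.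
rewrite -lee_fin fineK; last by near: t.
apply/expansion_modulus_le => x y xy; apply: hd; apply: le_trans xy _.
by near: t; exact: nbhs_right_le.
Unshelve. all: by end_near.
Qed.

(** A segment of length at most [n * d] is cut into [n] steps of length at most
    [d]. *)
Lemma large_scale_lipschitz f d C : 0 <= d ->
  (forall x y, `|x - y| <= d -> `|f x - f y| <= C) ->
  forall n x y, `|x - y| <= n%:R * d -> `|f x - f y| <= n%:R * C.
Proof.
move=> d0 hf; elim=> [|n IH] x y.
  by rewrite !mul0r !normr_le0 !subr_eq0 => /eqP ->.
move=> xy; pose z := y + (n%:R / n.+1%:R) *: (x - y).
have n1 : n.+1%:R != 0 :> R by rewrite pnatr_eq0.
have zy : `|z - y| <= n%:R * d.
  rewrite /z addrC addKr normrZ ger0_norm ?divr_ge0 //.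
  by rewrite mulrAC ler_pdivrMr // -mulrA (mulrC d) ler_wpM2l.
have xz : `|x - z| <= d.
  have -> : x - z = n.+1%:R^-1 *: (x - y).
    have -> : n.+1%:R^-1 = 1 - n%:R / n.+1%:R :> R by rewrite -natr1; field; rewrite natr1.
    by rewrite /z; vector_ring.
  by rewrite normrZ ger0_norm ?invr_ge0 // ler_pdivrMl.
have -> : f x - f y = (f x - f z) + (f z - f y) by vector_ring.
apply: le_trans (ler_normD _ _) _.
by rewrite -natr1 mulrDl mul1r addrC lerD // ?IH // hf.
Qed.

End Moduli.

Lemma uniform_inverse_of_expansion (R : realType) (X Y : normedModType R)
    (f : X -> Y) (g : Y -> X) :
  cancel f g -> continuous f ->
  (forall e : R, 0 < e -> exists2 d, 0 < d &
    forall x y, `|f x - f y| < d -> `|x - y| < e) ->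
  homeomorphism_onto_range f g /\ unif_continuous_on (range f) g.
Proof.
move=> fg cf h.
have ug : unif_continuous_on (range f) g.
  move=> E; rewrite -entourage_ballE => -[e /= e0 eE].
  have [d d0 hd] := h e e0.
  exists [set p : Y * Y | ball p.1 d p.2].
    by rewrite -entourage_ballE; exists d.
  move=> [u v] /= uv; apply: eE => /=.
  case: uv => [->|[[x _ <-] [[y _ <-] xy]]]; first exact: ballxx.
  by rewrite !fg -ball_normE; apply: hd; move: xy; rewrite -ball_normE.
split=> //; split=> //.
move=> y; apply/cvg_entourageP => E entE.
have := nbhs_entourage y (ug E entE); apply: filterS => z.
by rewrite /xsection /= inE.
Qed.

(** * Embeddings into minimal spaces *)

Section Embeddings.
Context {R : realType}.

Lemma nat_ge (r : R) : exists n : nat, r <= n%:R.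
Proof.
exists (Num.bound `|r|); apply: le_trans (ler_norm r) _.
by apply/ltW/archi_boundP.
Qed.

Lemma nat_le_pow2 n : n%:R <= 2 ^+ n :> R.
Proof. by rewrite -natrX ler_nat ltnW // ltn_expl. Qed.

Lemma pow2V n : 2 ^+ n * 2^-1 ^+ n = 1 :> R.
Proof. by rewrite -exprMn divff // expr1n. Qed.

Lemma half_pow_small (e : R) : 0 < e -> exists2 N, (0 < N)%N & 2 * 2^-1 ^+ N <= e.
Proof.
move=> e0; have [n hn] := nat_ge (2 / e); exists n.+1 => //.
have p0 : 0 < 2^-1 ^+ n :> R by rewrite exprn_gt0 // invr_gt0.
have := pow2V n; have := nat_le_pow2 n; move: hn; rewrite ler_pdivrMr //.
rewrite exprS => h1 h2 h3.
have : 2 * 2^-1 ^+ n <= n%:R * e * 2^-1 ^+ n by rewrite ler_pM2r.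
have : n%:R * e * 2^-1 ^+ n <= 2 ^+ n * e * 2^-1 ^+ n by rewrite !ler_pM2r.
have -> : 2 ^+ n * e * 2^-1 ^+ n = (2 ^+ n * 2^-1 ^+ n) * e by ring.
by rewrite h3; lra.
Qed.

Lemma sum_small (T : Type) (A : R -> set T) (h : nat -> T -> R) :
  (forall d d', d <= d' -> A d `<=` A d') ->
  (forall n e, 0 < e -> exists2 d, 0 < d & forall t, A d t -> h n t <= e) ->
  forall N e, 0 < e -> exists2 d, 0 < d &
    forall t, A d t -> \sum_(0 <= n < N) h n t <= e.
Proof.
move=> Amono hh; elim=> [|N IH] e e0.
  by exists 1 => // t _; rewrite big_geq // ltW.
have e2 : 0 < e / 2 by lra.
have [d d0 hd] := IH _ e2; have [d' d'0 hd'] := hh N _ e2.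
exists (Num.min d d') => [|t At]; first by rewrite lt_min d0.
rewrite big_nat_recr //=.
have dd : Num.min d d' <= d by rewrite ge_min lexx.
have dd' : Num.min d d' <= d' by rewrite ge_min lexx orbT.
by have := hd t (Amono _ _ dd _ At); have := hd' t (Amono _ _ dd' _ At); lra.
Qed.

End Embeddings.

(** At distance at most [n], the [n]-th map moves points by an amount governed
    by the modulus of [f] at [n / a n], which can be made as small as desired
    by the choice of [a n]; this absorbs the growth [L ^ n.+1] of the operators.
    Uniform continuity of the sum then implies coarseness, since balls of [X]
    are connected by chains of small steps. *)
Lemma uniform_embedding_coarse (R : realType) (X Y : completeNormedModType R)
    (f : X -> Y) : minimal_space Y -> uniform_embedding f ->
  exists F : X -> Y, coarse_embedding F /\ uniform_embedding F.
Proof.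
move=> /minimal_square[T1 [T2 [L [L0 T1L T2L T12]]]].
move=> /uniform_embeddingP[hu hl].
have Ln n : 0 < L ^+ n by rewrite exprn_gt0.
have half0 n : 0 < 2^-1 ^+ n :> R by rewrite exprn_gt0 // invr_gt0.
have /choice[a ha] n : exists a : R, 0 < a /\ forall x y : X, `|x - y| <= n%:R ->
    L ^+ n.+1 * (n%:R * `|f (a^-1 *: x) - f (a^-1 *: y)|) <= 2^-1 ^+ n.
  have D0 : 0 < L ^+ n.+1 * n.+1%:R by rewrite mulr_gt0.
  have [d d0 hd] := hu _ (divr_gt0 (half0 n) D0).
  have a0 : 0 < 1 + n%:R / d by rewrite ltr_pwDl // divr_ge0 // ltW.
  exists (1 + n%:R / d); split=> // x y xy.
  have : `|f ((1 + n%:R / d)^-1 *: x) - f ((1 + n%:R / d)^-1 *: y)| <=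
      2^-1 ^+ n / (L ^+ n.+1 * n.+1%:R).
    apply: hd; rewrite -scalerBr normrZ gtr0_norm ?invr_gt0 // ler_pdivrMl //.
    by apply: le_trans xy _; rewrite mulrDl mul1r divfK ?gt_eqF // lerDr ltW.
  rewrite ler_pdivlMr // => h; apply: le_trans h.
  rewrite [leRHS]mulrC -mulrA ler_pM2l // ler_wpM2r // ler_nat; exact: leqnSn.
pose F_ n x := n%:R *: (f ((a n)^-1 *: x) - f 0).
have F_E n x y : `|F_ n x - F_ n y| = n%:R * `|f ((a n)^-1 *: x) - f ((a n)^-1 *: y)|.
  rewrite -[n%:R in RHS]ger0_norm // -normrZ; congr (`|_|).
  by rewrite /F_; vector_ring.
have F_0 n : F_ n 0 = 0 by rewrite /F_ scaler0 subrr scaler0.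
have tail n x y : `|x - y| <= n%:R -> L ^+ n.+1 * `|F_ n x - F_ n y| <= 2^-1 ^+ n.
  by rewrite F_E; exact: (ha n).2.
have [x|F [Fge Fle]] := superposition L0 T1L T2L T12 (f := F_).
  have [N hN] := nat_ge `|x|; exists N => n Nn.
  rewrite -[F_ n x]subr0 -(F_0 n); apply: tail; rewrite subr0.
  by apply: le_trans hN _; rewrite ler_nat.
have F_unif n (e : R) : 0 < e -> exists2 d, 0 < d & forall p : X * X,
    `|p.1 - p.2| <= d -> L ^+ n.+1 * `|F_ n p.1 - F_ n p.2| <= e.
  move=> e0; have [a0 _] := ha n.
  have D0 : 0 < L ^+ n.+1 * n.+1%:R by rewrite mulr_gt0.
  have [d d0 hd] := hu _ (divr_gt0 e0 D0).
  exists (a n * d) => [|[x y] /= xy]; first exact: mulr_gt0.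
  have := hd ((a n)^-1 *: x) ((a n)^-1 *: y).
  rewrite -scalerBr normrZ gtr0_norm ?invr_gt0 // ler_pdivrMl // => /(_ xy).
  rewrite ler_pdivlMr // => h; apply: le_trans h; rewrite F_E.
  rewrite [leRHS]mulrC -mulrA ler_pM2l // ler_wpM2r // ler_nat; exact: leqnSn.
have F_uc (e : R) : 0 < e ->
    exists2 d, 0 < d & forall x y, `|x - y| <= d -> `|F x - F y| <= e.
  move=> e0; have e2 : 0 < e / 2 by lra.
  have [N N0 hN] := half_pow_small e2.
  have [|d d0 hd] := sum_small (A := fun d => [set p : X * X | `|p.1 - p.2| <= d])
    (h := fun n p => L ^+ n.+1 * `|F_ n p.1 - F_ n p.2|) _ F_unif N e2.
    by move=> d d' dd p /= pd; exact: le_trans dd.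
  exists (Num.min d 1) => [|x y]; first by rewrite lt_min d0 ltr01.
  rewrite le_min => /andP[xd x1]; apply: le_trans (Fle N x y _) _.
    move=> n Nn; apply: tail; apply: le_trans x1 _.
    by rewrite ler1n (leq_trans N0 Nn).
  by have := hd (x, y) xd; rewrite /=; lra.
exists F; split; last first.
  apply/uniform_embeddingP; split=> // t t0.
  have [a0 _] := ha 1%N.
  have [c c0 hc] := hl _ (divr_gt0 t0 a0).
  exists c => // x y xy; apply: le_trans (Fge 1%N x y).
  rewrite F_E mul1r; apply: hc; rewrite -scalerBr normrZ gtr0_norm ?invr_gt0 //.
  by rewrite mulrC ler_pM2l // invr_gt0.
split.
  apply/coarseP => t t0; have [d d0 hd] := F_uc 1 ltr01.
  have [n hn] := nat_ge (t / d); exists (n%:R * 1) => x y xy.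
  apply: (large_scale_lipschitz (ltW d0) hd); apply: le_trans xy _.
  by rewrite -ler_pdivrMr.
apply/expandingP => C.
have [c c0 hc] := hl 1 ltr01; have [n hn] := nat_ge (C / c).
exists (a n) => x y xy; apply: le_trans (Fge n x y); rewrite F_E.
have [a0 _] := ha n.
apply: (@le_trans _ _ (n%:R * c)); first by rewrite -ler_pdivrMr.
rewrite ler_wpM2l // hc // -scalerBr normrZ gtr0_norm ?invr_gt0 //.
by rewrite ler_pdivlMl // mulr1.
Qed.

Lemma coarse_embedding_continuous (R : realType) (X Y : normedModType R) (f : X -> Y) :
  coarse_embedding f -> exists2 g : X -> Y, coarse_embedding g & continuous g.
Proof.
move=> [/coarseP hc /expandingP he].
have [C hC] := hc 1 ler01.
have [g gc gf] := continuous_approximation hC.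
exists g => //; split.
  apply/coarseP => t t0; have [D hD] := hc t t0; exists (C + D + C) => x y xy.
  have -> : g x - g y = (g x - f x) + (f x - f y) - (g y - f y) by vector_ring.
  apply: le_trans (ler_normB _ _) _; apply: lerD (gf y).
  by apply: le_trans (ler_normD _ _) _; apply: lerD (gf x) (hD _ _ xy).
apply/expandingP => D; have [t ht] := he (C + D + C); exists t => x y /ht.
have -> : f x - f y = (g x - g y) - (g x - f x) + (g y - f y) by vector_ring.
have := ler_normD ((g x - g y) - (g x - f x)) (g y - f y).
have := ler_normB (g x - g y) (g x - f x).
by have := gf x; have := gf y; lra.
Qed.

(** A coarse map grows at most linearly, so [f (2 ^ n x)] grows at most like
    [2 ^ n] in [n]; the factor [8 ^ - n] in [b n] leaves [4 ^ - n] times the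
    linear growth in [x], which is eventually below [2 ^ - n] on every bounded
    set. *)
Lemma coarse_embedding_homeomorphism (R : realType) (X Y : completeNormedModType R)
    (f : X -> Y) : minimal_space Y -> coarse_embedding f ->
  exists (F : X -> Y) (g : Y -> X),
    [/\ coarse_embedding F, homeomorphism_onto_range F g &
        unif_continuous_on (range F) g].
Proof.
move=> /minimal_square[T1 [T2 [L [L0 T1L T2L T12]]]].
move=> /coarse_embedding_continuous[{}f [/coarseP hc /expandingP he] fc].
have [C hC] := hc 1 ler01.
have C0 : 0 <= C by have := hC 0 0; rewrite !subrr !normr0; apply.
have lip u v : `|f u - f v| <= C * (`|u - v| + 1).
  have /andP[h1 h2] := truncn_itv (normr_ge0 (u - v)).
  have := large_scale_lipschitz ler01 hC (n := (Num.truncn `|u - v|).+1) (x := u) (y := v).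
  rewrite mulr1 => /(_ (ltW h2)) h3; apply: le_trans h3 _.
  by rewrite mulrC ler_wpM2l // -natr1 lerD2r.
have Ln n : 0 < L ^+ n by rewrite exprn_gt0.
pose h n : R := 2^-1 ^+ n.
have h0 n : 0 < h n by rewrite exprn_gt0 // invr_gt0.
pose b n := (L ^+ n.+1)^-1 * (h n * h n * h n).
have b0 n : 0 < b n by rewrite !mulr_gt0 // invr_gt0.
pose F_ n x := b n *: (f (2 ^+ n *: x) - f 0).
have F_E n x y : `|F_ n x - F_ n y| = b n * `|f (2 ^+ n *: x) - f (2 ^+ n *: y)|.
  rewrite -[b n in RHS]gtr0_norm // -normrZ; congr (`|_|).
  by rewrite /F_; vector_ring.
have F_0 n : F_ n 0 = 0 by rewrite /F_ scaler0 subrr scaler0.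
have LF n x y : L ^+ n.+1 * `|F_ n x - F_ n y| =
    h n * h n * h n * `|f (2 ^+ n *: x) - f (2 ^+ n *: y)|.
  by rewrite F_E /b !mulrA divff ?mul1r // gt_eqF.
have LF_le n x y t : `|x - y| <= t -> L ^+ n.+1 * `|F_ n x - F_ n y| <=
    h n * h n * (C * (t + 1)).
  move=> xy; rewrite LF; apply: (@le_trans _ _ (h n * h n * h n * (C * (2 ^+ n * (t + 1))))).
    rewrite ler_pM2l ?mulr_gt0 //; apply: le_trans (lip _ _) _.
    rewrite ler_wpM2l // -scalerBr normrZ gtr0_norm ?exprn_gt0 //.
    have : 2 ^+ n * `|x - y| <= 2 ^+ n * t by rewrite ler_pM2l ?exprn_gt0.
    have : 1 <= 2 ^+ n :> R by rewrite exprn_ege1 // ler1n.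
    by rewrite mulrDr mulr1; lra.
  have -> : h n * h n * h n * (C * (2 ^+ n * (t + 1))) =
    2 ^+ n * h n * (h n * h n * (C * (t + 1))) by ring.
  by rewrite pow2V mul1r.
have tail N t : C * (t + 1) <= N%:R -> forall x y, `|x - y| <= t ->
    forall n, (N <= n)%N -> L ^+ n.+1 * `|F_ n x - F_ n y| <= h n.
  move=> hN x y xy n Nn; apply: le_trans (LF_le n x y t xy) _.
  rewrite -[leRHS]mulr1 -mulrA ler_pM2l // -[leRHS](pow2V n) mulrC ler_pM2r //.
  by apply: le_trans hN _; apply: le_trans (nat_le_pow2 n); rewrite ler_nat.
have [x|F [Fge Fle]] := superposition L0 T1L T2L T12 (f := F_).
  have [N hN] := nat_ge (C * (`|x| + 1)); exists N => n Nn.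
  by rewrite -[F_ n x]subr0 -(F_0 n); apply: (tail _ _ hN); rewrite ?subr0.
have F_coarse : coarse F.
  apply/coarseP => t t0; have [N hN] := nat_ge (C * (t + 1)).
  exists (\sum_(0 <= n < N) h n * h n * (C * (t + 1)) + 2 * 2^-1 ^+ N) => x y xy.
  apply: le_trans (Fle N x y (tail _ _ hN _ _ xy)) _; rewrite lerD2r.
  by apply: ler_sum => n _; exact: LF_le.
have F_exp : expanding F.
  apply/expandingP => D; have [t ht] := he (D / b 0%N); exists t => x y /ht xy.
  by apply: le_trans (Fge 0%N x y); rewrite F_E !scale1r -ler_pdivrMl // mulrC.
have F_cont : continuous F.
  move=> x; apply/cvgrPdist_le => e e0; have e2 : 0 < e / 2 by lra.
  have [N1 hN1] := nat_ge (C * (1 + 1)); have [N2 _ hN2] := half_pow_small e2.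
  pose N := maxn N1 N2.
  have hN : C * (1 + 1) <= N%:R by apply: le_trans hN1 _; rewrite ler_nat leq_maxl.
  have hN' : 2 * 2^-1 ^+ N <= e / 2.
    apply: le_trans hN2; rewrite ler_pM2l // ler_wiXn2l ?leq_maxr //.
    by rewrite invf_le1 // ler1n.
  have F_near n (d : R) : 0 < d -> exists2 r, 0 < r & forall y, `|x - y| <= r ->
      L ^+ n.+1 * `|F_ n x - F_ n y| <= d.
    move=> d0; have H0 : 0 < h n * h n * h n by rewrite !mulr_gt0.
    have /cvgrPdist_le/(_ _ (divr_gt0 d0 H0))/nbhs_ballP[r /= r0 hr] := fc (2 ^+ n *: x).
    exists (r / 2 ^+ n.+1) => [|y xy]; first by rewrite divr_gt0 // exprn_gt0.
    rewrite LF mulrC -ler_pdivlMr //; apply: hr.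
    rewrite -ball_normE /= -scalerBr normrZ gtr0_norm ?exprn_gt0 //.
    move: xy; rewrite ler_pdivlMr ?exprn_gt0 // exprS; lra.
  have [|r r0 hr] := sum_small (A := fun d => [set y : X | `|x - y| <= d])
    (h := fun n y => L ^+ n.+1 * `|F_ n x - F_ n y|) _ F_near N e2.
    by move=> d d' dd y /= yd; exact: le_trans dd.
  apply/nbhs_ballP; exists (Num.min r 1) => /=; first by rewrite lt_min r0 ltr01.
  move=> y; rewrite -ball_normE /= lt_min => /andP[xr x1].
  apply: le_trans (Fle N x y (tail _ _ hN _ _ (ltW x1))) _.
  by have := hr y (ltW xr); lra.
have F_inv (e : R) : 0 < e -> exists2 d, 0 < d &
    forall x y, `|F x - F y| < d -> `|x - y| < e.
  move=> e0; have [s hs] := he 1; have [n hn] := nat_ge (s / e).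
  exists (b n) => // x y xy; rewrite ltNge; apply/negP => exy.
  have : `|F_ n x - F_ n y| < b n by apply: le_lt_trans xy; exact: Fge.
  rewrite F_E -[ltRHS]mulr1 ltr_pM2l // ltNge; apply/negP/negPn.
  apply: hs; rewrite -scalerBr normrZ gtr0_norm ?exprn_gt0 //.
  move: hn; rewrite ler_pdivrMr // => hn; apply: le_trans hn _.
  by apply: ler_pM => //; [exact: ltW|exact: nat_le_pow2].
pose g y := xget 0 [set x | F x = y].
have Fg : cancel F g.
  move=> x; have gx : F (g (F x)) = F x.
    by have := @xgetPex _ 0 [set z | F z = F x]; apply; exists x.
  apply/eqP; rewrite -subr_eq0 -normr_le0 leNgt; apply/negP => /F_inv[d d0].
  by move=> /(_ (g (F x)) x); rewrite gx subrr normr0 ltxx => /(_ d0).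
by exists F, g; have [] := uniform_inverse_of_expansion Fg F_cont F_inv.
Qed.

Theorem theorem1p2 (R : realType) (X Y : completeNormedModType R)
    (hY : minimal_space Y) :
  ((exists f : X -> Y, uniform_embedding f) ->
   exists f : X -> Y, coarse_embedding f /\ uniform_embedding f) /\
  ((exists f : X -> Y, coarse_embedding f) ->
   exists (f : X -> Y) (g : Y -> X),
     [/\ coarse_embedding f, homeomorphism_onto_range f g &
         unif_continuous_on (range f) g]).
Proof.
split=> -[f hf]; first exact: uniform_embedding_coarse hf.
exact: coarse_embedding_homeomorphism hf.
Qed.
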